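(* Suppose $1/n\ll1/K\ll\lambda\ll\alpha$. If $G$ is a digraph of order $(1+\alpha)n$ with $\delta^0(G)\ge(1/2+\alpha)n$, then $G$ contains every oriented tree $T$ of order $n$ with $\Delta(T)\le n^{(K\log n)^{-1/2}}$.
   Context: Hierarchy notation: $a\ll b$ means for every $b>0$ there is $a_0>0$ such that the statement holds for all $0<a<a_0$; for chains the constants are chosen right to left; $1/n\ll\cdot$ means $n$ sufficiently large. $\log$ is the natural logarithm. A digraph has no loops and at most one edge in each direction; $\delta^0(G)$ is the minimum over vertices of the minimum of in- and outdegree. An oriented tree is an orientation of a tree; $\Delta(T)$ is the maximum degree of the underlying tree. ''$G$ contains $T$'' means $G$ has a subdigraph isomorphic to $T$. *)

(* Defs.v *)
From mathcomp Require Import all_boot all_order all_algebra.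
From mathcomp Require Import reals exp.

Set Implicit Arguments.
Unset Strict Implicit.
Unset Printing Implicit Defensive.

Import Order.TTheory GRing.Theory Num.Theory.

(* A boolean relation [e] on the vertex type carries at most one edge in each
   direction by construction; both [e x y] and [e y x] are allowed. *)
Definition digraph (V : finType) (e : rel V) : Prop := irreflexive e.

Definition outdeg (V : finType) (e : rel V) (x : V) : nat :=
  #|[set y | e x y]|.
Definition indeg (V : finType) (e : rel V) (x : V) : nat :=
  #|[set y | e y x]|.

(* The default value #|V| of the iterated minimum is an upper bound on all
   degrees, so it only matters when V is empty. *)
Definition min_semidegree (V : finType) (e : rel V) : nat :=
  \big[minn/#|V|]_(x : V) minn (outdeg e x) (indeg e x).

Definition underlying (V : finType) (e : rel V) : rel V :=
  [rel x y | e x y || e y x].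

Definition max_degree (V : finType) (g : rel V) : nat :=
  \max_(x : V) #|[set y | g x y]|.

Definition acyclic_graph (V : finType) (g : rel V) : Prop :=
  forall c : seq V, 2 < size c -> ~~ ucycleb g c.

Definition tree (V : finType) (g : rel V) : Prop :=
  [/\ 0 < #|V|, symmetric g, irreflexive g,
      (forall x y : V, connect g x y) & acyclic_graph g].

(* [oriented]: no pair of vertices is joined by edges in both directions,
   so that [e] orients each edge of its underlying graph exactly once. *)
Definition oriented (V : finType) (e : rel V) : Prop :=
  forall x y : V, e x y -> ~~ e y x.

Definition oriented_tree (V : finType) (e : rel V) : Prop :=
  oriented e /\ tree (underlying e).

(* The images of the vertices and edges of H under [f] form a subdigraph
   of G, not necessarily induced, which is isomorphic to H. *)
Definition contains (V : finType) (eG : rel V) (W : finType) (eH : rel W)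
    : Prop :=
  exists f : W -> V, injective f /\ forall x y : W, eH x y -> eG (f x) (f y).

(* [m] is the floor or the ceiling of [x]; an order prescribed by a real
   expression is meant up to such a rounding. *)
Definition rounds (R : realType) (m : nat) (x : R) : Prop :=
  (m%:Z = Num.floor x)%R \/ (m%:Z = Num.ceil x)%R.

(* Main.v *)
(* A nonnegative potential steers a deterministic embedding, so that no
   regularity lemma is needed.  Root T and cut it at every L-th level into pieces
   of depth less than L, hence of size n^o(1), and embed the pieces one after the
   other.  The invariant is that, U being the set of unused vertices of G, every
   vertex has a proportion at least 1/2 + 1/t of U among its outneighbours, and
   likewise among its inneighbours.

   Under this invariant G[U] carries integer edge weights in [1, 4 t^2] all of
   whose in- and outsums are equal.  The random walks along, and against, the
   corresponding doubly stochastic matrix preserve the mean of a function on U,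
   and one step multiplies its oscillation by at most 1 - 1/t^2 because any two
   vertices have many common neighbours.  Thus a random walk embedding of a piece
   puts all but its first few levels nearly uniformly on U.  The method of
   conditional expectations turns this into an embedding of the piece for which
   the sum of exp (- theta * proportion), over all vertices and both directions,
   grows by a factor close to 1; so no proportion ever gets too small. *)
Require Import Defs.
From mathcomp Require Import all_boot all_order all_algebra.
From mathcomp Require Import reals sequences exp.
From mathcomp Require Import zify ring lra.

Set Implicit Arguments.
Unset Strict Implicit.
Unset Printing Implicit Defensive.

Import Order.TTheory GRing.Theory Num.Theory.

(** * Balanced edge weights *)

Section BalancedWeights.
Variables (V : finType) (U : {set V}) (e : rel V) (t : nat).
Local Notation N := #|U|.

Definition admissible (w : V -> V -> nat) : Prop :=
  [/\ forall x y, w x y <= 4 * t ^ 2,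
      forall x y, (0 < w x y) = [&& x \in U, y \in U & e x y],
      forall x, x \in U -> \sum_(y in U) w x y <= 2 * t * N
    & forall y, y \in U -> \sum_(x in U) w x y <= 2 * t * N].

Hypothesis t_gt0 : 0 < t.
Hypothesis outdegU : forall x, x \in U ->
  (t + 2) * N <= 2 * t * #|[set y in U | e x y]|.
Hypothesis indegU : forall x, x \in U ->
  (t + 2) * N <= 2 * t * #|[set y in U | e y x]|.

Lemma sum_pair (A : {set V}) (x b : V) u : b \in A ->
  \sum_(v in A) ((u == x) && (v == b) : nat) = (u == x).
Proof.
move=> bA; rewrite (bigD1 b) //= eqxx andbT big1 ?addn0 // => v /andP[_ /negPf->].
by rewrite andbF.
Qed.

Lemma few_saturated (g : V -> nat) (D : {set V}) :
  0 < N -> D \subset U -> \sum_(y in U) g y <= 2 * t * N ->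
  (t + 2) * N <= 2 * t * #|D| ->
  (t + 1) * N <= 2 * t * #|[set y in D | g y < 4 * t ^ 2]|.
Proof.
move=> N_gt0 DU gM Dbig.
set D1 := [set y in D | _].
have cD : #|D| = #|D1| + #|D :\: D1|.
  have sD : D1 \subset D by apply/subsetP => y; rewrite inE => /andP[].
  by rewrite -(cardsID D1 D) (setIidPr sD).
have : #|D :\: D1| * (4 * t ^ 2) <= 2 * t * N.
  apply: leq_trans gM; rewrite -sum_nat_const.
  apply: (@leq_trans (\sum_(y in D :\: D1) g y)).
    by apply: leq_sum => y; rewrite !inE => /andP[+ yD]; rewrite yD /= -leqNgt.
  rewrite [leqRHS](bigID (mem (D :\: D1))) /=; apply: leq_trans (leq_addr _ _).
  apply: eq_leq; apply: eq_bigl => y.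
  case yD: (y \in D :\: D1); rewrite ?andbF // andbT.
  by move: yD; rewrite inE => /andP[_ /(subsetP DU)->].
nia.
Qed.

(* If no deficient pair can be joined directly, raise the weights of the two
   outer edges of a path x -> b <- a -> y and lower that of the middle one. *)
Lemma augment (w : V -> V -> nat) (x y : V) :
  admissible w -> x \in U -> y \in U ->
  \sum_(v in U) w x v < 2 * t * N -> \sum_(v in U) w v y < 2 * t * N ->
  exists2 w', admissible w' &
    \sum_(u in U) \sum_(v in U) w' u v = (\sum_(u in U) \sum_(v in U) w u v).+1.
Proof.
move=> [wC wE wO wI] xU yU xdef ydef.
have direct a b : a \in U -> b \in U -> e a b -> w a b < 4 * t ^ 2 ->
    \sum_(v in U) w a v < 2 * t * N -> \sum_(v in U) w v b < 2 * t * N ->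
  exists2 w', admissible w' &
    \sum_(u in U) \sum_(v in U) w' u v = (\sum_(u in U) \sum_(v in U) w u v).+1.
  move=> aU bU eab wab adef bdef.
  pose w' u v := w u v + ((u == a) && (v == b)).
  have outE u : \sum_(v in U) w' u v = \sum_(v in U) w u v + (u == a).
    by rewrite big_split /= sum_pair.
  have inE' v : \sum_(u in U) w' u v = \sum_(u in U) w u v + (v == b).
    rewrite big_split /=; congr (_ + _).
    by under eq_bigr do rewrite andbC; rewrite sum_pair.
  exists w'.
    split=> [u v|u v|u uU|v vU]; rewrite ?outE ?inE'.
    - rewrite /w'; have [->|_] /= := eqVneq u a; last by rewrite addn0.
      by have [->|_] := eqVneq v b; rewrite ?addn0 // addn1.
    - rewrite /w' addn_gt0 wE; case: eqVneq => [->|_]; last by rewrite orbF.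
      by case: eqVneq => [->|_]; rewrite ?orbF // aU bU eab.
    - by case: eqVneq => [->|_]; rewrite ?addn0 ?wO // addn1.
    - by case: eqVneq => [->|_]; rewrite ?addn0 ?wI // addn1.
  under eq_bigr do rewrite outE; rewrite big_split /= -addn1; congr (_ + _).
  rewrite (bigD1 a) //= eqxx big1 // => i /andP[_ /negPf ->] //.
have N_gt0 : 0 < N by apply/card_gt0P; exists x.
pose A := [set a in [set a in U | e a y] | w a y < 4 * t ^ 2].
pose B := [set b in [set b in U | e x b] | w x b < 4 * t ^ 2].
have cA : (t + 1) * N <= 2 * t * #|A|.
  apply: few_saturated => //; last exact: indegU; last exact: ltnW.
  by apply/subsetP => a; rewrite inE => /andP[].
have cB : (t + 1) * N <= 2 * t * #|B|.
  apply: few_saturated => //; last exact: outdegU; last exact: ltnW.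
  by apply/subsetP => a; rewrite inE => /andP[].
have [/existsP[a /andP[aA adef]]|/existsPn Asat] :=
    boolP [exists a, (a \in A) && (\sum_(v in U) w a v < 2 * t * N)].
  by move: aA; rewrite !inE => /andP[/andP[aU eay] way]; apply: (direct a y).
have [/existsP[b /andP[bB bdef]]|/existsPn Bsat] :=
    boolP [exists b, (b \in B) && (\sum_(v in U) w v b < 2 * t * N)].
  by move: bB; rewrite !inE => /andP[/andP[bU eby] wby]; apply: (direct x b).
have AU : A \subset U by apply/subsetP => a; rewrite !inE => /andP[/andP[]].
have BU : B \subset U by apply/subsetP => a; rewrite !inE => /andP[/andP[]].
have {}Asat a : a \in A -> \sum_(v in U) w a v = 2 * t * N.
  move=> aA; have := Asat a; rewrite aA /= -leqNgt => h.
  by apply/eqP; rewrite eqn_leq h wO // (subsetP AU).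
have {}Bsat a : a \in B -> \sum_(v in U) w v a = 2 * t * N.
  move=> aA; have := Bsat a; rewrite aA /= -leqNgt => h.
  by apply/eqP; rewrite eqn_leq h wI // (subsetP BU).
have [/existsP[a /existsP[b /and3P[aA bB wab]]]|noAB] :=
    boolP [exists a, exists b, [&& a \in A, b \in B & 1 < w a b]]; last first.
  (* Otherwise the saturated set A sends weight at most 1 along each edge to B,
     and the complement of B is too small to absorb the rest. *)
  have wAB : \sum_(a in A) \sum_(b in B) w a b <= #|A| * #|B|.
    rewrite -sum_nat_const; apply: leq_sum => a aA.
    rewrite -sum1_card; apply: leq_sum => b bB; rewrite leqNgt.
    apply/negP => wab; case/negP: noAB; apply/existsP; exists a.
    by apply/existsP; exists b; rewrite aA bB.
  have wAU : \sum_(a in A) \sum_(b in U) w a b = #|A| * (2 * t * N).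
    by rewrite -sum_nat_const; apply: eq_bigr => a; exact: Asat.
  have wAB' : \sum_(a in A) \sum_(b in U :\: B) w a b <= (N - #|B|) * (2 * t * N).
    rewrite exchange_big /= -cardsDS // -sum_nat_const; apply: leq_sum => b.
    rewrite inE => /andP[_ bU]; apply: leq_trans (wI b bU).
    rewrite [leqRHS](bigID (mem A)) /=; apply: leq_trans (leq_addr _ _).
    apply: eq_leq; apply: eq_bigl => v.
    by case vA: (v \in A); rewrite ?andbF // (subsetP AU).
  have : \sum_(a in A) \sum_(b in U) w a b <=
      \sum_(a in A) \sum_(b in B) w a b + \sum_(a in A) \sum_(b in U :\: B) w a b.
    rewrite -big_split /=; apply: leq_sum => a _.
    by rewrite (big_setID B) /= (setIidPr BU).
  have := subset_leq_card AU; have := subset_leq_card BU.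
  nia.
have [aU bU] : a \in U /\ b \in U by rewrite (subsetP AU) ?(subsetP BU).
have ax : a != x by apply: contraTneq xdef => <-; rewrite Asat // ltnn.
have yb : b != y by apply: contraTneq ydef => <-; rewrite Bsat // ltnn.
move: aA bB; rewrite !inE => /andP[/andP[_ eay] way] /andP[/andP[_ exb] wxb].
pose w' u v := w u v + ((u == x) && (v == b)) + ((u == a) && (v == y))
                - ((u == a) && (v == b)).
have w'E u v : w' u v + ((u == a) && (v == b)) =
    w u v + ((u == x) && (v == b)) + ((u == a) && (v == y)).
  rewrite subnK //; have [->|_] //= := eqVneq u a.
  by have [->|_] //= := eqVneq v b; move: wab; clear; lia.
have sumr (z1 z2 : V) v : z1 \in U ->
    \sum_(u in U) ((u == z1) && (v == z2) : nat) = (v == z2).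
  by move=> z1U; under eq_bigr do rewrite andbC; rewrite sum_pair.
have outE u : \sum_(v in U) w' u v = \sum_(v in U) w u v + (u == x).
  apply: (@addIn (u == a)); rewrite -{1}(sum_pair a u bU) -big_split /=.
  by under eq_bigr do rewrite w'E; rewrite !big_split /= !sum_pair.
have inE' v : \sum_(u in U) w' u v = \sum_(u in U) w u v + (v == y).
  apply: (@addIn (v == b)); rewrite -{1}(sumr a b v aU) -big_split /=.
  by under eq_bigr do rewrite w'E; rewrite !big_split /= !sumr //; clear; lia.
exists w'.
  split=> [u v|u v|u uU|v vU]; rewrite ?outE ?inE'.
  - rewrite /w'; have := wC u v; have [->|_] /= := eqVneq u a.
      rewrite (negPf ax) /=; have [->|_] /= := eqVneq v y; last by clear; lia.
      by move: way; clear; lia.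
    move: wxb; have [->|_] /= := eqVneq u x; have [->|_] /= := eqVneq v b;
      by clear; lia.
  - rewrite /w' -wE; have [->|ua] /= := eqVneq u a.
      rewrite (negPf ax) /=; have [->|_] /= := eqVneq v b.
        by move: wab; clear; lia.
      have [->|_] /= := eqVneq v y; last by clear; lia.
      by rewrite (wE a y) aU yU eay; clear; lia.
    have [->|_] /= := eqVneq u x; have [->|_] /= := eqVneq v b; try (by clear; lia).
    by rewrite (wE x b) xU bU exb; clear; lia.
  - by case: eqVneq => [->|_]; rewrite ?addn0 ?wO // addn1.
  - by case: eqVneq => [->|_]; rewrite ?addn0 ?wI // addn1.
under eq_bigr do rewrite outE; rewrite big_split /= -addn1; congr (_ + _).
rewrite (bigD1 x) //= eqxx big1 // => i /andP[_ /negPf ->] //.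
Qed.

Lemma balanced_weights :
  exists2 w, admissible w &
    (forall x, x \in U -> \sum_(y in U) w x y = 2 * t * N) /\
    (forall y, y \in U -> \sum_(x in U) w x y = 2 * t * N).
Proof.
pose tot (w : V -> V -> nat) := \sum_(u in U) \sum_(v in U) w u v.
have deficit (g : V -> nat) : (forall x, x \in U -> g x <= 2 * t * N) ->
    \sum_(x in U) g x < N * (2 * t * N) -> exists2 x, x \in U & g x < 2 * t * N.
  move=> gM; rewrite -sum_nat_const => lt.
  have [/existsP[x /andP[xU gx]]|/existsPn h] :=
    boolP [exists x, (x \in U) && (g x < 2 * t * N)]; first by exists x.
  exfalso; move: lt; rewrite ltnNge => /negP; apply; apply: leq_sum => x xU.
  by have := h x; rewrite xU /= -leqNgt.
have full (g : V -> nat) : (forall x, x \in U -> g x <= 2 * t * N) ->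
    N * (2 * t * N) <= \sum_(x in U) g x -> forall x, x \in U -> g x = 2 * t * N.
  move=> gM ge x xU; apply/eqP; rewrite eqn_leq gM //= leqNgt; apply/negP => lt.
  move: ge; rewrite leqNgt => /negP; apply; rewrite -sum_nat_const.
  rewrite (bigD1 x) //= [ltnRHS](bigD1 x) //= -addSn leq_add //.
  by apply: leq_sum => y /andP[yU _]; exact: gM.
have [w0 w0A] : exists w, admissible w.
  exists (fun x y => [&& x \in U, y \in U & e x y] : nat).
  have le1 (P : pred V) : \sum_(x in U) (P x : nat) <= 2 * t * N.
    apply: (@leq_trans N); last by nia.
    by rewrite -sum1_card; apply: leq_sum => x _; case: (P x).
  split=> [x y|x y|x xU|y yU]; rewrite ?le1 //.
  - by case: [&& _, _ & _] => //=; nia.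
  - by rewrite lt0b.
have [m] := ubnP (N * (2 * t * N) - tot w0).
elim: m w0 w0A => // m IH w wA lem; have [_ _ wO wI] := wA.
have [h|h] := leqP (N * (2 * t * N)) (tot w).
  by exists w => //; split; apply: full => //; rewrite exchange_big.
have [x xU xdef] := deficit _ wO h.
rewrite /tot exchange_big /= in h; have [y yU ydef] := deficit _ wI h.
have [w' w'A w'E] := augment wA xU yU xdef ydef.
apply: (IH w') => //; rewrite /tot w'E; rewrite exchange_big /= in h.
by move: lem h; rewrite /tot; lia.
Qed.

End BalancedWeights.

(** * Rooted trees *)

Definition rooted_at (W : finType) (g : rel W) (z : W) (par : W -> W)
    (lev : W -> nat) : Prop :=
  [/\ forall x, lev (par x) = (lev x).-1,
      forall x, (lev x == 0) = (x == z),
      forall x, 0 < lev x -> g (par x) x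
    & forall x y, g x y -> 0 < lev y /\ par y = x \/ 0 < lev x /\ par x = y].

Lemma tree_edge_cut (W : finType) (g : rel W) (x y : W) : tree g -> g x y ->
  ~~ connect [rel u v | g u v && ~~ ((u == x) && (v == y) || (u == y) && (v == x))]
       x y.
Proof.
move=> [_ gsym girr _ gacyc] gxy; apply/negP => /connectP[p gp yp].
case/shortenP: gp yp => {}p gp up _ yp.
have pg : path g x p by apply: sub_path gp => u v /andP[].
have : ~~ ucycleb g (x :: p).
  apply: gacyc; case: p gp yp {up pg} => [|a [|b p]] //=.
    by move=> _ E; move: gxy; rewrite E girr.
  by move=> /andP[/andP[_ h] _] E; move: h; rewrite E !eqxx.
by rewrite /ucycleb up andbT /= rcons_path pg -yp gsym gxy.
Qed.

Lemma tree_rooted (W : finType) (g : rel W) : tree g ->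
  exists z par lev, rooted_at g z par lev.
Proof.
move=> treeg; have [/card_gt0P[z _] gsym girr gconn _] := treeg.
pose reach x n := [exists p : n.-tuple W, path g z p && (last z p == x)].
have reachP x n : reflect (exists p, [/\ size p = n, path g z p & last z p = x])
    (reach x n).
  apply: (iffP existsP) => [[p /andP[gp /eqP lp]]|[p [/eqP sp gp lp]]].
    by exists p; rewrite size_tuple.
  by exists (Tuple sp); rewrite /= gp lp eqxx.
have exr x : exists n, reach x n.
  have /connectP[p gp lp] := gconn z x.
  by exists (size p); apply/reachP; exists p.
pose lev x := ex_minn (exr x).
have lev_min x p : path g z p -> last z p = x -> lev x <= size p.
  by move=> gp lp; rewrite /lev; case: ex_minnP => n _; apply; apply/reachP; exists p.
have levP x : exists p, [/\ size p = lev x, path g z p & last z p = x].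
  by rewrite /lev; case: ex_minnP => n /reachP.
have lev0 x : (lev x == 0) = (x == z).
  apply/eqP/eqP => [x0|->]; last by apply/eqP; rewrite -leqn0 (lev_min z [::]).
  by have [p [+ _ <-]] := levP x; rewrite x0 => /size0nil->.
have pred x : 0 < lev x -> exists y, g y x && (lev y == (lev x).-1).
  move=> x0; have [p [sp gp lp]] := levP x.
  case/lastP: p sp gp lp => [|p a]; first by move=> E; rewrite -E in x0.
  rewrite size_rcons rcons_path last_rcons => sp /andP[gp ga] ax; subst a.
  exists (last z p); rewrite ga -sp /= eqn_leq lev_min //=.
  have [q [sq gq lq]] := levP (last z p); rewrite -ltnS sp -sq.
  by rewrite -(size_rcons q x) lev_min ?last_rcons // rcons_path gq lq.
pose par x := if [pick y | g y x && (lev y == (lev x).-1)] is Some y then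
  (if lev x == 0 then x else y) else x.
have parP x : 0 < lev x -> g (par x) x && (lev (par x) == (lev x).-1).
  move=> x0; rewrite /par; case: pickP => [y|h]; last first.
    by have [y] := pred x x0; rewrite h.
  by rewrite eqn0Ngt x0.
have par0 x : lev x = 0 -> par x = x.
  by move=> x0; rewrite /par; case: pickP => // y; rewrite x0 eqxx.
exists z, par, lev; split=> //.
- move=> x; have [x0|x0] := posnP (lev x); first by rewrite par0 // x0.
  by have /andP[_ /eqP] := parP x x0.
- by move=> x /parP/andP[].
move=> x y gxy.
have [/andP[y0 /eqP yx]|nyx] := boolP ((0 < lev y) && (par y == x)); first by left.
have [/andP[x0 /eqP xy]|nxy] := boolP ((0 < lev x) && (par x == y)); first by right.
exfalso; have := tree_edge_cut treeg gxy; set g' := (X in connect X) => /negP; apply.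
have g'sym : connect_sym g'.
  apply: sym_connect_sym => u v; rewrite /g' /= gsym; congr (_ && ~~ _).
  by rewrite orbC; congr (_ || _); rewrite andbC.
have zg' w : connect g' z w.
  have [k] := ubnP (lev w); elim: k w => // k IH w lw.
  have [w0|w0] := posnP (lev w).
    by move/eqP: w0; rewrite lev0 => /eqP->.
  have /andP[gw /eqP lw'] := parP w w0.
  apply: (@connect_trans _ _ (par w)).
    by apply: IH; rewrite lw' prednK.
  apply: connect1; rewrite /g' /= gw /=; apply/norP; split; apply/negP.
    by move=> /andP[/eqP pw /eqP wy]; move: nyx; rewrite -wy w0 pw eqxx.
  by move=> /andP[/eqP pw /eqP wx]; move: nxy; rewrite -wx w0 pw eqxx.
by apply: (@connect_trans _ _ z); rewrite // g'sym.
Qed.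

Lemma size_children (W : finType) (g : rel W) z par lev x : symmetric g ->
  rooted_at g z par lev ->
  #|[set c | (0 < lev c) && (par c == x)]| <= max_degree g.
Proof.
move=> gsym [_ _ gpar _]; apply: leq_trans (leq_bigmax x).
rewrite subset_leq_card //; apply/subsetP => c; rewrite !inE => /andP[c0 /eqP <-].
exact: gpar.
Qed.

Local Open Scope ring_scope.

(** * Mixing of the random walks *)

Definition arc (V : finType) (e : rel V) (b : bool) (u v : V) : bool :=
  if b then e u v else e v u.

Section Kernel.
Variables (R : realFieldType) (V : finType) (U : {set V}) (e : rel V) (t : nat).
Local Notation N := #|U|.

(* [m] is a common part of the two distributions [a] and [c]. *)
Lemma osc_contraction (a c m f : V -> R) (k o : R) :
  U != set0 ->
  {in U, forall v, m v <= a v /\ m v <= c v} ->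
  \sum_(v in U) a v = 1 -> \sum_(v in U) c v = 1 -> k <= \sum_(v in U) m v ->
  {in U &, forall x y, f x - f y <= o} ->
  \sum_(v in U) a v * f v - \sum_(v in U) c v * f v <= (1 - k) * o.
Proof.
move=> /set0Pn[x0 x0U] mac suma sumc summ fo.
case: (arg_minP f x0U) => z zU fz.
have o_ge0 : 0 <= o by rewrite -(subrr (f z)) fo.
have shift (g : V -> R) : \sum_(v in U) g v = 1 ->
    \sum_(v in U) g v * f v =
    \sum_(v in U) (g v - m v) * (f v - f z) + \sum_(v in U) m v * f v
      + f z * (1 - \sum_(v in U) m v).
  move=> <-; rewrite -sumrB mulr_sumr -!big_split /=; apply: eq_bigr => v _; ring.
rewrite (shift a) // (shift c) //.
have up : \sum_(v in U) (a v - m v) * (f v - f z) <= (1 - k) * o.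
  apply: (@le_trans _ _ (\sum_(v in U) (a v - m v) * o)).
    by apply: ler_sum => v vU; rewrite ler_wpM2l ?fo // subr_ge0; case: (mac v vU).
  rewrite -mulr_suml sumrB suma ler_wpM2r // lerB //.
have lo : 0 <= \sum_(v in U) (c v - m v) * (f v - f z).
  by apply: sumr_ge0 => v vU; rewrite mulr_ge0 ?subr_ge0 ?fz //; case: (mac v vU).
lra.
Qed.

Definition mixing_kernel (p : bool -> V -> V -> R) : Prop :=
  [/\ forall b u v, 0 <= p b u v <= 2 * t%:R / N%:R,
      forall b u v, 0 < p b u v -> (v \in U) && arc e b u v,
      forall b u, u \in U -> \sum_(v in U) p b u v = 1,
      forall b v, v \in U -> \sum_(u in U) p b u v = 1
    & forall b (f : V -> R) (o : R), {in U &, forall x y, f x - f y <= o} ->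
      {in U &, forall x y, \sum_(v in U) p b x v * f v -
         \sum_(v in U) p b y v * f v <= (1 - (t%:R ^+ 2)^-1) * o}].

Lemma exists_mixing_kernel :
  (0 < t)%N -> U != set0 ->
  (forall b x, x \in U -> (t + 2) * N <= 2 * t * #|[set y in U | arc e b x y]|)%N ->
  exists p, mixing_kernel p.
Proof.
move=> t_gt0 U0 degU.
have [w [wC wE wO wI] [wOE wIE]] :=
  balanced_weights t_gt0 (degU true) (degU false).
have N_gt0 : (0 < N)%N by rewrite card_gt0.
have tR : 0 < t%:R :> R by rewrite ltr0n.
have NR : 0 < N%:R :> R by rewrite ltr0n.
pose wb b u v := if b then w u v else w v u.
pose p b u v : R := (wb b u v)%:R / (2 * t * N)%:R.
have M_gt0 : 0 < (2 * t * N)%:R :> R by rewrite ltr0n; lia.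
have rows b u : u \in U -> \sum_(v in U) p b u v = 1.
  move=> uU; rewrite -mulr_suml -natr_sum.
  suff -> : (\sum_(v in U) wb b u v = 2 * t * N)%N by rewrite divff // gt_eqF.
  by case: b; rewrite /wb ?wOE ?wIE.
have wb_gt0 b u v : (0 < wb b u v)%N = [&& u \in U, v \in U & arc e b u v].
  by case: b; rewrite /wb wE //= andbCA.
exists p; split=> //.
- move=> b u v; rewrite divr_ge0 ?ler0n //= ler_pdivrMr // 2!natrM.
  have -> : 2 * t%:R / N%:R * (2%:R * t%:R * N%:R) = (4 * t ^ 2)%:R :> R.
    by rewrite natrM natrX; field; rewrite gt_eqF.
  by rewrite ler_nat /wb; case: b.
- move=> b u v; rewrite pmulr_lgt0 ?invr_gt0 // ltr0n wb_gt0.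
  by case/and3P=> _ -> ->.
- move=> b v vU; rewrite -(rows (~~ b) v vU); apply: eq_bigr => u _.
  by rewrite /p /wb; case: b.
move=> b f o fo x y xU yU.
pose C := [set v in U | arc e b x v] :&: [set v in U | arc e b y v].
pose m v : R := if v \in C then (2 * t * N)%:R^-1 else 0.
have cardC : (2 * N <= t * #|C|)%N.
  have := degU b x xU; have := degU b y yU.
  have := cardsUI [set v in U | arc e b x v] [set v in U | arc e b y v].
  have : (#|[set v in U | arc e b x v] :|: [set v in U | arc e b y v]| <= N)%N.
    by rewrite subset_leq_card //; apply/subsetP => v; rewrite !inE; case: (v \in U).
  rewrite -/C; move: t_gt0; clear; nia.
apply: (@osc_contraction _ _ m) => //; try exact: rows.
  move=> v vU; rewrite /m; case: ifP => [|_]; last first.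
    by split; rewrite divr_ge0 ?ler0n.
  rewrite !inE vU /= => /andP[xv yv].
  have gt a : a \in U -> arc e b a v -> (2 * t * N)%:R^-1 <= p b a v.
    move=> aU av; rewrite /p -[leLHS]mul1r ler_wpM2r ?invr_ge0 ?ler0n //.
    by rewrite (ler_nat _ 1) wb_gt0 aU vU.
  by split; apply: gt.
rewrite (bigID (mem C)) /= [X in _ + X]big1 ?addr0; last first.
  by move=> v /andP[_ /negPf vC]; rewrite /m vC.
have -> : \sum_(i in U | i \in C) m i = \sum_(i in C) (2 * t * N)%:R^-1.
  apply: eq_big => [v|v /andP[_ vC]]; last by rewrite /m vC.
  by rewrite !inE; case: (v \in U).
rewrite sumr_const -[_ *+ #|C|]mulr_natl ler_pdivlMr // mulrC ler_pdivrMr ?exprn_gt0 //.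
rewrite -natrX -natrM ler_nat; move: cardC t_gt0; clear; nia.
Qed.

End Kernel.

(** * Embedding one piece *)

Section Pieces.
Variables (W : finType) (par : W -> W) (lev : W -> nat).
Hypothesis lev_par : forall x, lev (par x) = (lev x).-1.

Definition children (x : W) : seq W :=
  [seq c <- enum W | (0 < lev c)%N & par c == x].

Fixpoint piece (h : nat) (x : W) : seq W :=
  if h is h'.+1 then x :: flatten [seq piece h' c | c <- children x]
  else [:: x].

Lemma mem_children x c : (c \in children x) = (0 < lev c)%N && (par c == x).
Proof. by rewrite mem_filter mem_enum andbT. Qed.

Lemma lev_child x c : c \in children x -> lev c = (lev x).+1.
Proof. by rewrite mem_children => /andP[c0 /eqP <-]; rewrite lev_par prednK. Qed.

Lemma lev_iter j x : lev (iter j par x) = (lev x - j)%N.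
Proof. by elim: j => [|j IH]; rewrite ?subn0 //= lev_par IH -subnS. Qed.

Lemma mem_piece h x y : (y \in piece h x) =
  (lev x <= lev y <= lev x + h)%N && (iter (lev y - lev x) par y == x).
Proof.
elim: h x => [|h IH] x /=.
  rewrite inE addn0 -eqn_leq; apply/eqP/andP => [->|[/eqP<-]].
    by rewrite subnn.
  by rewrite subnn => /eqP.
rewrite inE; apply/orP/andP => [[/eqP->|/flatten_mapP[c cx]]|[/andP[xy yh]]].
- by rewrite subnn leqnn leq_addr.
- rewrite IH (lev_child cx) => /andP[/andP[xy yh] /eqP yc].
  rewrite ltnW //= addnS -addSn yh; split=> //.
  by rewrite -(subnSK xy) iterS yc; move: cx; rewrite mem_children => /andP[].
case: (posnP (lev y - lev x)) => [->|nxy]; first by left.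
rewrite -(prednK nxy) iterS => yx; right.
have lt : (lev x < lev y)%N by rewrite -subn_gt0.
have cl : lev (iter (lev y - lev x).-1 par y) = (lev x).+1.
  by rewrite lev_iter; move: lt; clear; lia.
apply/flatten_mapP; exists (iter (lev y - lev x).-1 par y).
  by rewrite mem_children cl yx.
by rewrite IH cl lt addSn -addnS yh subnS /=.
Qed.

Lemma piece_root h x : x \in piece h x.
Proof. by rewrite mem_piece subnn leqnn leq_addr /=. Qed.

Lemma par_piece h x y : y \in piece h x -> y != x -> par y \in piece h x.
Proof.
rewrite !mem_piece => /andP[/andP[xy yh] yx] nyx.
have lt : (lev x < lev y)%N.
  rewrite ltn_neqAle xy andbT; apply: contraNneq nyx => E.
  by move: yx; rewrite E subnn /= => /eqP->.
move: yx; rewrite -(subnSK lt) iterSr lev_par => yx.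
have -> : ((lev y).-1 - lev x = lev y - (lev x).+1)%N by move: lt; clear; lia.
by rewrite yx andbT; move: lt yh; clear; lia.
Qed.

Lemma piece_children_inj h x c c' y : c \in children x -> c' \in children x ->
  y \in piece h c -> y \in piece h c' -> c = c'.
Proof.
move=> cx cx'; rewrite !mem_piece (lev_child cx) (lev_child cx').
by move=> /andP[_ /eqP<-] /andP[_ /eqP<-].
Qed.

Lemma uniq_piece h x : uniq (piece h x).
Proof.
elim: h x => [//|h IH] x /=; apply/andP; split.
  apply/negP => /flatten_mapP[c cx]; rewrite mem_piece (lev_child cx).
  by rewrite ltnn.
have : {subset children x <= children x} by [].
have : uniq (children x) by rewrite filter_uniq ?enum_uniq.
elim: {1 2 4}(children x) => [//|c cs IHcs] /= /andP[ncs ucs] sub.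
rewrite cat_uniq IH IHcs //=; last by move=> d dcs; rewrite sub // inE dcs orbT.
rewrite andbT; apply/hasPn => y /flatten_mapP[c' c'cs yc']; apply/negP => yc.
by rewrite (piece_children_inj (sub _ _) (sub _ _) yc yc') ?inE ?eqxx ?c'cs ?orbT // in ncs.
Qed.

Lemma size_piece D h x : (forall y, size (children y) <= D)%N ->
  (size (piece h x) <= D.+1 ^ h)%N.
Proof.
move=> chD; elim: h x => [//|h IH] x /=.
rewrite size_flatten /shape -map_comp sumnE big_map expnS mulSn.
apply: (@leq_ltn_trans (D * D.+1 ^ h)); last first.
  by rewrite -[X in (X < _)%N]add0n ltn_add2r expn_gt0.
apply: (@leq_trans (size (children x) * D.+1 ^ h)); last by rewrite leq_mul.
elim: (children x) => [|c cs IHcs]; rewrite ?big_nil //= big_cons mulSn.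
by rewrite leq_add // IH.
Qed.

Section Embed.
Variables (R : realFieldType) (V : finType) (U : {set V}) (e : rel V).
Variables (p : bool -> V -> V -> R) (kappa rho : R) (s : nat) (sgn : W -> bool).
Variable F : V -> R.
Hypothesis p_bound : forall b u v, 0 <= p b u v <= kappa.
Hypothesis p_supp : forall b u v, 0 < p b u v -> (v \in U) && arc e b u v.
Hypothesis p_row : forall b u, u \in U -> \sum_(v in U) p b u v = 1.
Hypothesis rho_ge0 : 0 <= rho.
Hypothesis rho_s : 1 <= rho * (1 - kappa * s%:R).
Hypothesis F_ge0 : forall v, 0 <= F v.

(* An upper bound for the expected sum of F over the image of a piece rooted at y
   when y is sent to u and the others follow the random walk; the factor rho per
   level pays for conditioning the walk to avoid used vertices. *)
Fixpoint pieceval (h : nat) (y : W) (u : V) : R :=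
  F u + (if h is h'.+1 then
    rho * \sum_(c <- children y) \sum_(v in U) p (sgn c) u v * pieceval h' c v
  else 0).

Lemma pieceval_ge0 h y u : 0 <= pieceval h y u.
Proof.
elim: h y u => [|h IH] y u /=; rewrite addr_ge0 // mulr_ge0 //.
apply: sumr_ge0 => c _; apply: sumr_ge0 => v _; rewrite mulr_ge0 //.
by have /andP[] := p_bound (sgn c) u v.
Qed.

Lemma kernel_pick b u (g : V -> R) (X : {set V}) :
  (forall v, 0 <= g v) -> u \in U -> (#|X| <= s)%N ->
  exists2 v, [&& v \in U, v \notin X & arc e b u v] &
    g v <= rho * \sum_(v' in U) p b u v' * g v'.
Proof.
move=> g0 uU Xs; set P := \sum_(v' in U) _.
have p0 v : 0 <= p b u v by have /andP[] := p_bound b u v.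
have P0 : 0 <= P by apply: sumr_ge0 => v _; rewrite mulr_ge0.
have k0 : 0 <= kappa.
  by have /andP[h0 h1] := p_bound b u u; apply: le_trans h1.
have free : 1 - kappa * s%:R <= \sum_(v in U :\: X) p b u v.
  have := p_row b uU; rewrite (big_setID X) /=.
  suff : \sum_(v in U :&: X) p b u v <= kappa * s%:R by lra.
  apply: (@le_trans _ _ (\sum_(v in U :&: X) kappa)).
    by apply: ler_sum => v _; have /andP[] := p_bound b u v.
  rewrite sumr_const -[_ *+ #|_|]mulr_natr ler_wpM2l // ler_nat.
  by apply: leq_trans Xs; rewrite subset_leq_card // subsetIr.
have [/existsP[v /and4P[vU vX uv gv]]|/existsPn h] := boolP [exists v,
   [&& v \in U, v \notin X, arc e b u v & g v <= rho * P]].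
  by exists v => //; apply/and3P.
exfalso.
have rho0 : 0 < rho.
  rewrite lt_def rho_ge0 andbT; apply/eqP => E; move: rho_s.
  by rewrite E mul0r ler10.
have f0 : 0 < 1 - kappa * s%:R.
  by rewrite -(pmulr_rgt0 _ rho0); apply: lt_le_trans rho_s.
have pg v : v \in U :\: X -> p b u v * (rho * P) <= p b u v * g v.
  rewrite inE => /andP[vX vU].
  have [p1|] := ltP 0 (p b u v); last first.
    move=> p1; have -> : p b u v = 0 by apply/le_anti; rewrite p1 p0.
    by rewrite !mul0r.
  rewrite ler_pM2l //; have := h v; have /andP[_ ->] := p_supp p1.
  by rewrite vX vU /= -ltNge => /ltW.
have [v vUX pv] : exists2 v, v \in U :\: X & 0 < p b u v.
  apply/exists_inP; apply: contraTT f0 => /exists_inPn h'.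
  rewrite -leNgt; apply: le_trans free _; apply: sumr_le0 => v vUX.
  by rewrite leNgt h'.
have : \sum_(v in U :\: X) p b u v * (rho * P) < \sum_(v in U :\: X) p b u v * g v.
  rewrite (bigD1 v) //= [ltRHS](bigD1 v) //= ltr_leD //; last first.
    by apply: ler_sum => w /andP[wUX _]; exact: pg.
  rewrite ltr_pM2l //; have := h v; have /andP[_ ->] := p_supp pv.
  by move: vUX; rewrite inE => /andP[-> ->] /=; rewrite -ltNge.
rewrite -mulr_suml; apply/negP; rewrite -leNgt.
apply: (@le_trans _ _ P).
  rewrite /P [leRHS](big_setID X) /= lerDr.
  by apply: sumr_ge0 => w _; rewrite mulr_ge0.
apply: (@le_trans _ _ ((1 - kappa * s%:R) * (rho * P))).
  by rewrite mulrA [_ * rho]mulrC ler_peMl.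
by rewrite ler_wpM2r // mulr_ge0.
Qed.

Lemma piece_embed h y u (X : {set V}) :
  u \in U -> u \notin X -> (#|X| + size (piece h y) <= s)%N ->
  exists f : W -> V,
  [/\ f y = u, {in piece h y &, injective f},
      {in piece h y, forall c, (f c \in U) && (f c \notin X)},
      {in piece h y, forall c, c != y -> arc e (sgn c) (f (par c)) (f c)}
    & \sum_(c <- piece h y) F (f c) <= pieceval h y u].
Proof.
elim: h y u X => [|h IH] y u X uU uX szs.
  exists (fun=> u); split=> //.
  - by move=> a b; rewrite !inE => /eqP-> /eqP->.
  - by move=> c _; rewrite uU uX.
  - by move=> c; rewrite inE => ->.
  - by rewrite /= big_seq1 addr0.
have forest cs (Y : {set V}) : uniq cs -> {subset cs <= children y} ->
    (#|Y| + size (flatten [seq piece h c | c <- cs]) <= s)%N ->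
    exists f : W -> V,
    [/\ {in flatten [seq piece h c | c <- cs] &, injective f},
      {in flatten [seq piece h c | c <- cs], forall c, (f c \in U) && (f c \notin Y)},
      {in flatten [seq piece h c | c <- cs], forall c,
         arc e (sgn c) (if c \in cs then u else f (par c)) (f c)}
    & \sum_(c <- flatten [seq piece h c | c <- cs]) F (f c) <=
      rho * \sum_(c <- cs) \sum_(v in U) p (sgn c) u v * pieceval h c v].
  elim: cs Y => [|c cs IHcs] Y /=.
    by move=> _ _ _; exists (fun=> u); split=> //; rewrite !big_nil mulr0.
  move=> /andP[ncs ucs] sub; rewrite size_cat => sz.
  have cy : c \in children y by rewrite sub ?inE ?eqxx.
  have subcs : {subset cs <= children y}.
    by move=> d dcs; rewrite sub // inE dcs orbT.
  have [v /and3P[vU vY uv] vval] := @kernel_pick (sgn c) u (pieceval h c) Y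
    (pieceval_ge0 h c) uU (leq_trans (leq_addr _ _) sz).
  have [f1 [f1c f1inj f1U f1arc f1F]] : exists f : W -> V,
    [/\ f c = v, {in piece h c &, injective f},
      {in piece h c, forall d, (f d \in U) && (f d \notin Y)},
      {in piece h c, forall d, d != c -> arc e (sgn d) (f (par d)) (f d)}
    & \sum_(d <- piece h c) F (f d) <= pieceval h c v].
    by apply: IH => //; apply: leq_trans sz; rewrite leq_add2l leq_addr.
  pose Z := Y :|: [set f1 d | d in piece h c].
  have cZ : (#|Z| <= #|Y| + size (piece h c))%N.
    rewrite cardsU; apply: leq_trans (leq_subr _ _) _; rewrite leq_add2l.
    apply: leq_trans (leq_imset_card _ _) _; exact: card_size.
  have [|f2 [f2inj f2U f2arc f2F]] := IHcs Z ucs subcs.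
    by apply: leq_trans sz; rewrite addnA leq_add2r.
  set D2 := flatten _ in f2inj f2U f2arc f2F *.
  pose f w := if w \in piece h c then f1 w else f2 w.
  have disj w : w \in D2 -> w \notin piece h c.
    move=> /flatten_mapP[c' c'cs wc']; apply/negP => wc.
    have E := piece_children_inj cy (subcs _ c'cs) wc wc'.
    by rewrite E c'cs in ncs.
  have fD1 w : w \in piece h c -> f w = f1 w by rewrite /f => ->.
  have fD2 w : w \in D2 -> f w = f2 w by rewrite /f => /disj/negPf->.
  have cross a b : a \in piece h c -> b \in D2 -> f1 a <> f2 b.
    move=> ac bD E; have /andP[_] := f2U b bD.
    by rewrite inE -E negb_or => /andP[_ /negP]; apply; apply: imset_f.
  exists f; split.
  - move=> a b; rewrite !mem_cat => /orP[ac|aD] /orP[bc|bD].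
    + by rewrite !fD1 //; exact: f1inj.
    + by rewrite fD1 // fD2 // => /cross; case/(_ ac bD).
    + by rewrite fD2 // fD1 // => /esym/cross; case/(_ bc aD).
    + by rewrite !fD2 //; exact: f2inj.
  - move=> d; rewrite mem_cat => /orP[dc|dD]; first by rewrite fD1 // f1U.
    have /andP[dU] := f2U d dD; rewrite inE negb_or => /andP[dY _].
    by rewrite fD2 // dU dY.
  - move=> d; rewrite mem_cat => /orP[dc|dD].
      rewrite (fD1 d dc) inE; have [->|ndc] /= := eqVneq d c; first by rewrite f1c.
      case: ifP => [dcs|_]; last by rewrite fD1 ?par_piece // f1arc.
      exfalso; move: dc; rewrite mem_piece (lev_child cy) (lev_child (subcs _ dcs)).
      by rewrite subnn /= (negPf ndc) andbF.
    rewrite (fD2 d dD) inE; have ndc : d != c.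
      by apply: contraTneq dD => ->; apply/negP => /disj; rewrite piece_root.
    rewrite (negPf ndc) /=; have := f2arc d dD.
    case: ifP => // dcs; rewrite fD2 //.
    have /flatten_mapP[c' c'cs dc'] := dD; apply/flatten_mapP; exists c' => //.
    by rewrite par_piece //; apply: contraFneq dcs => ->.
  - rewrite big_cat big_cons mulrDr /= lerD //.
      apply: le_trans vval; apply: le_trans f1F.
      by rewrite (eq_big_seq (F \o f1)) //= => d /fD1/= ->.
    apply: le_trans f2F.
    by rewrite (eq_big_seq (F \o f2)) //= => d /fD2/= ->.
have /(_ (children y) (u |: X)) := forest.
case.
- by rewrite filter_uniq ?enum_uniq.
- by [].
- by move: szs; rewrite cardsU1 uX /= addnS add1n addSn.
move=> f; set D := flatten _ => -[finj fU farc fF].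
have yD : y \notin D by have := uniq_piece h.+1 y; rewrite /= => /andP[].
have nyD w : w \in D -> (w == y) = false.
  by move=> wD; apply: contraNF yD => /eqP <-.
have fu w : w \in D -> f w <> u.
  by move=> /fU/andP[_]; rewrite !inE negb_or => /andP[/eqP].
exists (fun w => if w == y then u else f w); split.
- by rewrite eqxx.
- move=> a b; rewrite !inE; case: eqVneq => [-> _|_ /= aD]; case: eqVneq => [-> _|_ /= bD] //.
  + by move=> /esym/fu; case/(_ bD).
  + by move=> /fu; case/(_ aD).
  + exact: finj.
- move=> c; rewrite inE; case: eqVneq => [_ _|_ /= cD]; first by rewrite uU uX.
  by have /andP[->] := fU c cD; rewrite !inE negb_or => /andP[_ ->].
- move=> c; rewrite inE => /orP[->//|cD] cy; rewrite (negPf cy).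
  have := farc c cD; case: ifP => [|/negbT cch].
    by rewrite mem_children => /andP[_ ->].
  rewrite ifF //; apply/negP => /eqP pc; case/negP: cch.
  rewrite mem_children pc eqxx andbT.
  have := par_piece (h := h.+1) (x := y) (y := c); rewrite mem_piece.
  have /flatten_mapP[c' c'y] := cD; rewrite mem_piece (lev_child c'y).
  by move=> /andP[/andP[lt _] _] _; apply: leq_trans lt.
- rewrite /= big_cons eqxx lerD2l; apply: le_trans fF.
  by rewrite (eq_big_seq (F \o f)) //= => d /nyD ->.
Qed.

Hypothesis p_col : forall b v, v \in U -> \sum_(u in U) p b u v = 1.
Variable gamma : R.
Hypothesis gamma_ge0 : 0 <= gamma.
Hypothesis p_mix : forall b (f : V -> R) (o : R),
  {in U &, forall x y, f x - f y <= o} ->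
  {in U &, forall x y, \sum_(v in U) p b x v * f v -
     \sum_(v in U) p b y v * f v <= gamma * o}.

Fixpoint weighted_count (a : R) (h : nat) (y : W) : R :=
  1 + (if h is h'.+1 then a * \sum_(c <- children y) weighted_count a h' c
       else 0).

Lemma weighted_countE a h y :
  weighted_count a h y = \sum_(x <- piece h y) a ^+ (lev x - lev y).
Proof.
elim: h y => [|h IH] y /=; first by rewrite big_seq1 subnn addr0.
rewrite big_cons subnn expr0; congr (1 + _).
have : {subset children y <= children y} by [].
elim: {1 3 4}(children y) => [|c cs IHcs] sub /=; first by rewrite !big_nil mulr0.
rewrite big_cat big_cons mulrDr IHcs /=; last first.
  by move=> d dcs; rewrite sub // inE dcs orbT.
congr (_ + _); rewrite IH mulr_sumr; apply: eq_big_seq => x.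
have /lev_child cl : c \in children y by rewrite sub // inE eqxx.
rewrite mem_piece cl => /andP[/andP[xy _] _].
by rewrite -exprS subnSK.
Qed.

Lemma sum_pieceval h y :
  \sum_(u in U) pieceval h y u = weighted_count rho h y * \sum_(u in U) F u.
Proof.
elim: h y => [|h IH] y /=; rewrite big_split /= ?sumr_const ?mul0rn.
  by rewrite !addr0 mul1r.
rewrite mulrDl mul1r -mulr_sumr exchange_big /= -mulrA mulr_suml.
congr (_ + rho * _); apply: eq_bigr => c _; rewrite -IH exchange_big /=.
by apply: eq_bigr => v vU; rewrite -mulr_suml p_col // mul1r.
Qed.

Lemma osc_pieceval (o : R) h y : {in U &, forall u v, F u - F v <= o} ->
  {in U &, forall u v,
    pieceval h y u - pieceval h y v <= weighted_count (rho * gamma) h y * o}.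
Proof.
move=> Fo; elim: h y => [|h IH] y u v uU vU /=.
  by rewrite !addr0 mul1r Fo.
rewrite opprD addrACA mulrDl mul1r lerD ?Fo //.
rewrite -mulrBr -!mulrA ler_wpM2l // mulr_suml mulr_sumr -sumrB.
apply: ler_sum => c _.
by apply: p_mix => //; exact: IH.
Qed.

Lemma pieceval_le (o : R) h y u : 1 <= rho -> u \in U -> 0 <= o ->
  {in U &, forall u v, F u - F v <= o} ->
  pieceval h y u <= rho ^+ h * ((size (piece h y))%:R *
     ((\sum_(v in U) F v) / #|U|%:R) + o * \sum_(x <- piece h y) gamma ^+ (lev x - lev y)).
Proof.
move=> rho1 uU o0 Fo.
have N0 : 0 < #|U|%:R :> R by rewrite ltr0n; apply/card_gt0P; exists u.
have rhox x : x \in piece h y -> rho ^+ (lev x - lev y) <= rho ^+ h.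
  rewrite mem_piece => /andP[/andP[_ xh] _].
  by rewrite ler_weXn2l // leq_subLR.
have A : weighted_count rho h y <= rho ^+ h * (size (piece h y))%:R.
  rewrite weighted_countE; apply: (@le_trans _ _ (\sum_(x <- piece h y) rho ^+ h)).
    by rewrite big_seq [leRHS]big_seq; apply: ler_sum => x /rhox.
  by rewrite big_const_seq count_predT iter_addr_0 mulr_natr.
have B : weighted_count (rho * gamma) h y <=
    rho ^+ h * \sum_(x <- piece h y) gamma ^+ (lev x - lev y).
  rewrite weighted_countE mulr_sumr big_seq [leRHS]big_seq.
  by apply: ler_sum => x /rhox hx; rewrite exprMn ler_wpM2r ?exprn_ge0.
have : \sum_(v in U) pieceval h y u <=
    \sum_(v in U) (pieceval h y v + weighted_count (rho * gamma) h y * o).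
  by apply: ler_sum => v vU; rewrite -lerBlDl; exact: osc_pieceval.
rewrite big_split /= !sumr_const sum_pieceval -(mulr_natr (pieceval h y u)).
rewrite -(mulr_natr (_ * o)).
rewrite -ler_pdivlMr // mulrDl mulfK ?gt_eqF // => /le_trans; apply.
rewrite mulrDr lerD //.
  by rewrite -mulrA [leRHS]mulrA ler_wpM2r // divr_ge0 ?sumr_ge0.
by rewrite [o * _]mulrC mulrA ler_wpM2r.
Qed.

End Embed.
End Pieces.

(** * The potential *)

Lemma expR_le_quadratic (R : realType) (x : R) :
  x <= 1 / 2 -> expR x <= 1 + x + 2 * x ^+ 2.
Proof.
move=> x12; have x1 : 0 < 1 - x by lra.
have : 1 - x <= expR (- x) by exact: expR_ge1Dx.
rewrite expRN => h; have ex := expR_gt0 x.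
have : (1 - x) * expR x <= 1.
  by rewrite -ler_pdivlMr // mul1r.
have : 1 <= (1 - x) * (1 + x + 2 * x ^+ 2).
  rewrite -subr_ge0; have -> : (1 - x) * (1 + x + 2 * x ^+ 2) - 1 =
    x ^+ 2 * (1 - 2 * x) by ring.
  by rewrite mulr_ge0 ?sqr_ge0 //; lra.
move=> h1 h2; rewrite -(ler_pM2l x1); exact: le_trans h1.
Qed.

Section Potential.
Variables (R : realType) (V : finType) (G : rel V).

Definition degin (U : {set V}) (i : bool * V) : nat :=
  #|[set u in U | arc G i.1 i.2 u]|.

Definition ratio (U : {set V}) (i : bool * V) : R :=
  (degin U i)%:R / #|U|%:R.

(* The sum runs over all vertices of G, used or not: used vertices may still have
   children to be embedded. *)
Definition potential (theta : R) (U : {set V}) : R :=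
  \sum_i expR (- theta * ratio U i).

Lemma degin_le U i : (degin U i <= #|U|)%N.
Proof. by rewrite subset_leq_card //; apply/subsetP => u; rewrite inE => /andP[]. Qed.

Lemma ratio_ge0 U i : 0 <= ratio U i.
Proof. by rewrite divr_ge0 ?ler0n. Qed.

Lemma ratio_le1 U i : ratio U i <= 1.
Proof.
have [U0|U0] := posnP #|U|; first by rewrite /ratio U0 invr0 mulr0 ler01.
by rewrite ler_pdivrMr ?ltr0n // mul1r ler_nat degin_le.
Qed.

Variables (W : finType) (par : W -> W) (lev : W -> nat) (sgn : W -> bool).
Hypothesis lev_par : forall x, lev (par x) = (lev x).-1.

Lemma potential_step (theta m eta : R) (t s h : nat) (y : W) (u : V)
    (U : {set V}) :
  let gamma := 1 - (t%:R ^+ 2)^-1 in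
  let Q := piece par lev h y in
  (0 < t)%N -> u \in U ->
  (forall i, (t + 2) * #|U| <= 2 * t * degin U i)%N ->
  (size Q <= s)%N -> (4 * t * s <= #|U|)%N ->
  0 <= theta -> 0 < m -> m <= #|U|%:R - (size Q)%:R -> theta * s%:R <= m / 2 ->
  eta <= 1 -> (1 + (4 * t * s)%:R / #|U|%:R) ^+ h <= 1 + eta ->
  exists f : W -> V,
  [/\ f y = u, {in Q &, injective f}, {in Q, forall c, f c \in U},
      {in Q, forall c, c != y -> arc G (sgn c) (f (par c)) (f c)}
    & potential theta (U :\: [set f c | c in Q]) <= potential theta U *
        expR (2 * (theta / m) ^+ 2 * s%:R * (size Q)%:R
          + theta / m * eta * (size Q)%:R
          + 2 * (theta / m) * \sum_(x <- Q) gamma ^+ (lev x - lev y))].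
Proof.
move=> gamma Q t_gt0 uU degU Qs tsU theta0 m0 mU thetas eta1 rhoh.
have U0 : U != set0 by apply/set0Pn; exists u.
have N0 : 0 < #|U|%:R :> R by rewrite ltr0n card_gt0.
have tR : 1 <= t%:R :> R by rewrite ler1n.
have [p [p_bound p_supp p_row p_col p_mix]] :=
  @exists_mixing_kernel R V U G t t_gt0 U0 (fun b x _ => degU (b, x)).
pose rho : R := 1 + (4 * t * s)%:R / #|U|%:R.
have rho1 : 1 <= rho by rewrite lerDl divr_ge0 ?ler0n.
have rho0 : 0 <= rho by apply: le_trans rho1.
have gamma0 : 0 <= gamma.
  by rewrite subr_ge0 invf_le1 ?exprn_ege1 // exprn_gt0 // (lt_le_trans ltr01).
pose w i := expR (- theta * ratio U i).
have w0 i : 0 <= w i by exact: expR_ge0.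
pose F v : R := \sum_i w i * (arc G i.1 i.2 v)%:R.
have F0 v : 0 <= F v by apply: sumr_ge0 => i _; rewrite mulr_ge0 ?ler0n.
pose Psi := potential theta U.
have Psi0 : 0 <= Psi by apply: sumr_ge0 => i _; exact: w0.
have Fo : {in U &, forall v v', F v - F v' <= Psi}.
  move=> v v' _ _; apply: (@le_trans _ _ (F v)); first by rewrite lerBlDr lerDl.
  by apply: ler_sum => i _; rewrite ler_piMr // lern1 leq_b1.
have rho_s : 1 <= rho * (1 - 2 * t%:R / #|U|%:R * s%:R).
  have -> : rho = 1 + 4 * (t%:R * s%:R / #|U|%:R).
    by rewrite /rho !natrM; ring.
  have -> : 2 * t%:R / #|U|%:R * s%:R = 2 * (t%:R * s%:R / #|U|%:R) :> R by ring.
  set x := _ / _; have x0 : 0 <= x by rewrite divr_ge0 // -natrM.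
  have : 4 * x <= 1.
    by rewrite /x mulrA ler_pdivrMr // mul1r mulrA -!natrM ler_nat.
  move=> x1; nra.
have uX : u \notin set0 by rewrite inE.
have szX : (#|set0 : {set V}| + size Q <= s)%N by rewrite cards0.
have [f [fy finj fU farc fF]] := @piece_embed W par lev lev_par R V U G p
  _ rho s sgn F p_bound p_supp p_row rho0 rho_s F0 h y u set0 uU uX szX.
exists f; split=> //; first by move=> c /fU/andP[].
pose Err := \sum_(x <- Q) gamma ^+ (lev x - lev y).
have Err0 : 0 <= Err by apply: sumr_ge0 => x _; rewrite exprn_ge0.
pose q : R := (size Q)%:R.
pose S := \sum_i w i * ratio U i.
have meanF : (\sum_(v in U) F v) / #|U|%:R = S.
  rewrite /F exchange_big mulr_suml; apply: eq_bigr => i _ /=.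
  rewrite -mulr_sumr -mulrA; congr (_ * (_ / _)).
  rewrite -natr_sum /degin -sum1_card; congr _%:R.
  rewrite big_mkcond [RHS]big_mkcond; apply: eq_bigr => v _.
  by rewrite inE; case: (v \in U); case: (arc _ _ _ _).
(* To first order, the potential changes by the linear functional
   theta / |U'| * (sum of F over the image - its mean), with F weighting each
   vertex by the terms of the potential that its use affects. *)
have {}fF : \sum_(c <- Q) F (f c) <= q * S + eta * q * Psi + 2 * Psi * Err.
  have S0 : 0 <= S by apply: sumr_ge0 => i _; rewrite mulr_ge0 ?ratio_ge0.
  have SPsi : S <= Psi by apply: ler_sum => i _; rewrite ler_piMr ?ratio_le1.
  have q0 : 0 <= q by exact: ler0n.
  have eta0 : 0 <= eta.
    by rewrite -(lerD2l 1) addr0; apply: le_trans rhoh; rewrite exprn_ege1.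
  apply: le_trans fF _.
  apply: le_trans (pieceval_le lev_par sgn rho0 F0 p_col gamma0 p_mix
    h y rho1 uU Psi0 Fo) _.
  rewrite meanF -/Q -/Err -/q.
  apply: (@le_trans _ _ ((1 + eta) * (q * S + Psi * Err))).
    by rewrite ler_wpM2r // addr_ge0 // mulr_ge0.
  have : eta * (q * S) <= eta * (q * Psi) by rewrite !ler_wpM2l.
  have : eta * (Psi * Err) <= Psi * Err by rewrite ler_piMl // mulr_ge0.
  lra.
pose X i : R := \sum_(c <- Q) (arc G i.1 i.2 (f c))%:R.
have sumX : \sum_i w i * X i = \sum_(c <- Q) F (f c).
  by rewrite exchange_big /=; apply: eq_bigr => i _; rewrite mulr_sumr.
pose U' := U :\: [set f c | c in Q].
have imU : [set f c | c in Q] \subset U.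
  by apply/subsetP => _ /imsetP[c /fU/andP[cU _] ->].
have uQ : uniq Q by exact: uniq_piece.
have cardU' : #|U'|%:R = #|U|%:R - q.
  rewrite cardsDS // card_in_imset // (card_uniqP uQ) natrB //.
  by rewrite -(card_uniqP uQ) -(card_in_imset finj) subset_leq_card.
have degU' i : (degin U' i)%:R = (degin U i)%:R - X i.
  apply/eqP; rewrite eq_sym subr_eq /X -natr_sum -natrD eqr_nat.
  rewrite /degin -(cardsID [set f c | c in Q]) addnC; apply/eqP; congr (_ + _)%N.
    by apply: eq_card => v; rewrite !inE; case: (v \in imset _ _); case: (v \in U).
  have -> : [set v in U | arc G i.1 i.2 v] :&: [set f c | c in Q] =
      [set f c | c in [pred c in Q | arc G i.1 i.2 (f c)]].
    apply/setP => v; rewrite !inE; apply/andP/imsetP => [[/andP[_ av]]|[c]].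
      by case/imsetP=> c cQ E; exists c; rewrite // inE /= cQ -E.
    by rewrite inE => /andP[cQ ac] ->; rewrite imset_f // ac;
      have /andP[-> _] := fU c cQ.
  rewrite card_in_imset; last first.
    by move=> a b; rewrite !inE => /andP[aQ _] /andP[bQ _]; exact: finj.
  rewrite -sum1_card big_uniq // big_mkcond [RHS]big_mkcond.
  apply: eq_bigr => c _; rewrite inE /= -/Q.
  by case: (c \in Q); case: (arc _ _ _ _).
have q0 : 0 <= q by exact: ler0n.
have qs : q <= s%:R by rewrite ler_nat.
pose a := theta / m.
have a0 : 0 <= a by rewrite divr_ge0 // ltW.
pose M := #|U'|%:R : R.
have mM : m <= M by rewrite /M cardU'.
have M0 : 0 < M by exact: lt_le_trans mM.
have aM : theta / M <= a.
  by rewrite ler_wpM2l // lef_pV2 ?posrE.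
have aM0 : 0 <= theta / M by rewrite divr_ge0 // ltW.
have as_ : a * s%:R <= 1 / 2.
  by rewrite /a mulrAC ler_pdivrMr //; move: thetas; lra.
have each i : expR (- theta * ratio U' i) <=
    w i * (1 + 2 * a ^+ 2 * (s%:R * q)) +
      theta / M * (w i * X i - q * (w i * ratio U i)).
  pose z := theta / M * (X i - q * ratio U i).
  have -> : - theta * ratio U' i = - theta * ratio U i + z.
    have -> : ratio U' i = ((degin U i)%:R - X i) / M by rewrite /ratio degU'.
    have E : #|U|%:R = M + q by rewrite /M cardU' subrK.
    rewrite /z /ratio E; field.
    by rewrite !gt_eqF // ltr_wpDr.
  rewrite expRD -/(w i).
  have X0 : 0 <= X i by apply: sumr_ge0.
  have Xq : X i <= q.
    rewrite /X -natr_sum ler_nat -sum1_size.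
    by apply: leq_sum => c _; exact: leq_b1.
  have r0 := ratio_ge0 U i; have r1 := ratio_le1 U i.
  have qr0 : 0 <= q * ratio U i by rewrite mulr_ge0.
  have qr1 : q * ratio U i <= q by rewrite ler_piMr.
  have zq : `|z| <= a * q.
    rewrite normrM ger0_norm // ler_pM ?normr_ge0 // ler_norml.
    by move: X0 Xq qr0 qr1; clear; move=> *; apply/andP; split; lra.
  have zs : a * q <= a * s%:R by rewrite ler_wpM2l.
  have z12 : z <= 1 / 2 by apply: le_trans (ler_norm _) _; lra.
  have z2 : z ^+ 2 <= a ^+ 2 * (s%:R * q).
    rewrite -real_normK ?num_real //.
    apply: (@le_trans _ _ ((a * q) ^+ 2)); first by rewrite !expr2 ler_pM.
    by rewrite exprMn ler_wpM2l ?sqr_ge0 // expr2 ler_wpM2r.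
  have -> : w i * (1 + 2 * a ^+ 2 * (s%:R * q)) +
        theta / M * (w i * X i - q * (w i * ratio U i)) =
     w i * (1 + z + 2 * (a ^+ 2 * (s%:R * q))) by rewrite /z; ring.
  rewrite ler_wpM2l //; apply: le_trans (expR_le_quadratic z12) _.
  by rewrite lerD2l ler_wpM2l.
rewrite -/U' {1}/potential; apply: le_trans (ler_sum _ (fun i _ => each i)) _.
rewrite big_split /= -mulr_suml -mulr_sumr sumrB -mulr_sumr sumX -/S.
rewrite -[\sum_i w i]/Psi -/Psi -/q -/Err -/a.
apply: (@le_trans _ _ (Psi * (1 + (2 * a ^+ 2 * s%:R * q + a * eta * q + 2 * a * Err))));
  last by rewrite ler_wpM2l // expR_ge1Dx.
have : theta / M * (\sum_(c <- Q) F (f c) - q * S) <= a * (eta * q * Psi + 2 * Psi * Err).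
  apply: (@le_trans _ _ (theta / M * (eta * q * Psi + 2 * Psi * Err))).
    by rewrite ler_wpM2l //; lra.
  rewrite ler_wpM2r // addr_ge0 // !mulr_ge0 //.
  by rewrite -(lerD2l 1) addr0; apply: le_trans rhoh; rewrite exprn_ege1.
lra.
Qed.

End Potential.

(** * Embedding the tree *)

Section Embedding.
Variables (R : realType) (V : finType) (G : rel V) (W : finType).
Variables (g : rel W) (z : W) (par : W -> W) (lev : W -> nat) (sgn : W -> bool).
Variables (t s L c : nat) (theta m eta : R).
Let gamma : R := 1 - (t%:R ^+ 2)^-1.
Hypothesis rooted : rooted_at g z par lev.
Hypothesis t_gt0 : (0 < t)%N.
Hypothesis L_gt0 : (0 < L)%N.
Hypothesis size_s : forall h y, (h < L)%N -> (size (piece par lev h y) <= s)%N.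
Hypothesis m_gt0 : 0 < m.
Hypothesis m_free : m <= #|V|%:R - #|W|%:R.
Hypothesis ts_m : (4 * t * s)%:R <= m.
Hypothesis theta_gt0 : 0 < theta.
Hypothesis theta_s : theta * s%:R <= m / 2.
Hypothesis eta_le1 : eta <= 1.
Hypothesis eta_L : (1 + (4 * t * s)%:R / m) ^+ L <= 1 + eta.

(* Bounds the deviation from uniformity of the image of x, where the cuts are at
   the levels congruent to - c modulo L.  The piece containing the root may start
   at a level not congruent to - c, so its vertices are bounded trivially. *)
Definition unmixed (x : W) : R :=
  if (lev x < L)%N then 1 else gamma ^+ ((lev x + c) %% L).

Let a := theta / m.
Let A := 2 * a ^+ 2 * s%:R + a * eta.

Hypothesis budget :
  potential G theta [set: V] * expR (A * #|W|%:R + 2 * a * \sum_x unmixed x)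
    < expR (- theta * (1 / 2 + t%:R^-1)).

Definition good_state (S : {set W}) (f : W -> V) : Prop :=
  [/\ {in S, forall x, par x \in S},
      forall x, x \notin S -> par x \in S -> (L %| lev x + c)%N,
      {in S &, injective f},
      {in S, forall x, (0 < lev x)%N -> arc G (sgn x) (f (par x)) (f x)}
    & potential G theta (~: [set f x | x in S]) <= potential G theta [set: V] *
        expR (A * #|S|%:R + 2 * a * \sum_(x in S) unmixed x)].

Lemma gamma_ge0 : 0 <= gamma.
Proof.
have tR : 1 <= t%:R :> R by rewrite ler1n.
by rewrite subr_ge0 invf_le1 ?exprn_ege1 // exprn_gt0 // (lt_le_trans ltr01).
Qed.

Lemma gamma_le1 : gamma <= 1.
Proof. by rewrite gerBl invr_ge0 exprn_ge0. Qed.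

Lemma unmixed_ge0 x : 0 <= unmixed x.
Proof. by rewrite /unmixed; case: ifP; rewrite ?exprn_ge0 ?gamma_ge0. Qed.

Lemma good_state_degree S f i : good_state S f ->
  ((t + 2) * #|~: [set f x | x in S]| <=
     2 * t * degin G (~: [set f x | x in S]) i)%N.
Proof.
move=> [_ _ _ _ psi]; set U := ~: _ in psi *.
have [->|U0] := posnP #|U|; first by rewrite muln0.
have a0 : 0 <= a by rewrite divr_ge0 // ltW.
have eta0 : 0 <= eta.
  rewrite -(lerD2l 1) addr0; apply: le_trans eta_L.
  by rewrite exprn_ege1 // lerDl divr_ge0 ?ler0n // ltW.
have A0 : 0 <= A.
  rewrite /A; apply: addr_ge0; last exact: mulr_ge0.
  by apply: mulr_ge0 (ler0n _ _); apply: mulr_ge0 (sqr_ge0 _).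
have lt : expR (- theta * ratio R G U i) < expR (- theta * (1 / 2 + t%:R^-1)).
  apply: le_lt_trans budget; apply: (@le_trans _ _ (potential G theta U)).
    rewrite /potential (bigD1 i) //= lerDl; apply: sumr_ge0 => j _.
    exact: expR_ge0.
  apply: le_trans psi _; rewrite ler_wpM2l //.
    by apply: sumr_ge0 => j _; exact: expR_ge0.
  rewrite ler_expR lerD //; first by rewrite ler_wpM2l // ler_nat max_card.
  apply: ler_wpM2l; first exact: mulr_ge0.
  rewrite [leRHS](bigID (mem S)) /= lerDl.
  by apply: sumr_ge0 => x _; exact: unmixed_ge0.
move: lt; rewrite ltr_expR !mulNr ltrN2 ltr_pM2l // /ratio.
rewrite ltr_pdivlMr ?ltr0n // => /ltW h.
rewrite -(ler_nat R) !natrM natrD.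
have tR : 0 < t%:R :> R by rewrite ltr0n.
have -> : (t%:R + 2) * #|U|%:R = 2 * t%:R * ((1 / 2 + t%:R^-1) * #|U|%:R) :> R.
  by field; rewrite gt_eqF.
by rewrite ler_wpM2l // mulr_ge0 // ltW.
Qed.

Lemma good_state_extend S f : good_state S f -> S != [set: W] ->
  exists S' f', good_state S' f' /\ (#|S| < #|S'|)%N.
Proof.
move=> good; have deg := good_state_degree _ good.
have [Spar Sbd finj farc psi] := good.
have [lev_par lev0 _ _] := rooted.
set U := ~: _ in psi deg => SW.
have [x0 x0S] : exists x, x \notin S.
  apply/existsP; rewrite -negb_forall; apply: contraNN SW => /forallP h.
  by apply/eqP/setP => x; rewrite inE h.
case: (@arg_minnP _ x0 (fun x => x \notin S) lev x0S) => x xS xmin {x0 x0S}.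
have parx : (0 < lev x)%N -> par x \in S.
  move=> lx; apply: contraT => /xmin; rewrite lev_par.
  by move: lx; clear; lia.
have cardU : #|U|%:R = #|V|%:R - #|S|%:R :> R.
  by rewrite /U cardsCs setCK card_in_imset // natrB // -(card_in_imset finj) max_card.
pose h := (L.-1 - (lev x + c) %% L)%N.
have hL : (h < L)%N by rewrite /h; move: L_gt0; clear; lia.
pose Q := piece par lev h x.
have uQ : uniq Q by exact: uniq_piece.
have Sit j y : y \in S -> iter j par y \in S.
  by elim: j => // j IH /IH/Spar.
have disj y : y \in Q -> y \notin S.
  rewrite mem_piece // => /andP[_ /eqP E]; apply: contra xS => yS.
  by rewrite -E Sit.
pose S' := S :|: [set y in Q].
have cardS' : #|S'| = (#|S| + size Q)%N.
  rewrite cardsU (_ : S :&: _ = set0) ?cards0 ?subn0.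
    by rewrite cardsE (card_uniqP uQ).
  apply/setP => y; rewrite !inE; apply/negP => /andP[yS /disj].
  by rewrite yS.
have sizeW : #|S|%:R + (size Q)%:R <= #|W|%:R :> R.
  by rewrite -natrD ler_nat -cardS' max_card.
have mU : m <= #|U|%:R - (size Q)%:R.
  by rewrite cardU; move: m_free sizeW; lra.
have U0 : (0 < #|U|)%N.
  by rewrite -(ltr_nat R); move: mU m_gt0 (ler0n R (size Q)); lra.
have [u uU uarc] : exists2 u, u \in U & (0 < lev x)%N -> arc G (sgn x) (f (par x)) u.
  have [lx|lx] := posnP (lev x).
    by have /card_gt0P[u uU] := U0; exists u.
  have : (0 < degin G U (sgn x, f (par x)))%N.
    by have := deg (sgn x, f (par x)); move: U0; clear; nia.
  by case/card_gt0P => u; rewrite inE => /andP[uU ux]; exists u.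
have mleU : m <= #|U|%:R by apply: le_trans mU _; rewrite gerBl.
have [f1 [f1x f1inj f1U f1arc f1psi]] := @potential_step R V G W par lev sgn
  lev_par theta m eta t s h x u U t_gt0 uU deg (size_s _ hL)
  ltac:(by rewrite -(ler_nat R); apply: le_trans mleU) (ltW theta_gt0) m_gt0 mU
  theta_s eta_le1 ltac:(
    apply: le_trans eta_L; apply: (@le_trans _ _ ((1 + (4 * t * s)%:R / m) ^+ h));
    [ apply: lerXn2r; rewrite ?nnegrE ?addr_ge0 ?divr_ge0 ?ler0n ?(ltW m_gt0) //;
      rewrite lerD2l ler_wpM2l // lef_pV2 ?posrE // ltr0n //
    | by rewrite ler_weXn2l ?(ltnW hL) // lerDl divr_ge0 ?ler0n // ltW ]).
pose f' w := if w \in Q then f1 w else f w.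
have f'Q w : w \in Q -> f' w = f1 w by rewrite /f' => ->.
have f'S w : w \in S -> f' w = f w.
  by rewrite /f'; case: ifP => // /disj/negPf->.
exists S', f'; split; last first.
  by rewrite cardS' -addn1 leq_add2l /Q; case: (h).
have cross w w' : w \in Q -> w' \in S -> f1 w <> f w'.
  move=> wQ w'S E; have := f1U w wQ; rewrite inE E => /negP; apply.
  exact: imset_f.
split.
- move=> y; rewrite !inE => /orP[/Spar->//|yQ].
  have [->|yx] := eqVneq y x; last by rewrite par_piece ?orbT.
  have [lx|/parx->//] := posnP (lev x).
  have /eqP zx : x == z by rewrite -lev0 lx.
  have /eqP -> : par x == x by rewrite {2}zx -lev0 lev_par lx.
  by rewrite piece_root ?orbT.
- move=> w; rewrite !inE negb_or => /andP[wS wQ] /orP[|pQ]; first exact: Sbd.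
  have lw : (0 < lev w)%N.
    rewrite lt0n lev0; apply: contraNneq wQ => wz; rewrite wz.
    suff <- : par w = z by [].
    by apply/eqP; rewrite -lev0 lev_par wz; have /eqP -> : lev z == 0%N by rewrite lev0.
  have lwE : lev w = (lev x + h).+1.
    move: pQ wQ; rewrite !mem_piece // lev_par.
    move=> /andP[/andP[xw wh] /eqP pw]; rewrite negb_and => /orP[|/eqP[]].
      by move: xw wh lw; clear; lia.
    have -> : (lev w - lev x = ((lev w).-1 - lev x).+1)%N by move: xw lw; clear; lia.
    by rewrite iterSr.
  rewrite lwE /h.
  have -> : ((lev x + (L.-1 - (lev x + c) %% L)).+1 + c =
      ((lev x + c) %/ L).+1 * L)%N.
    by have := divn_eq (lev x + c) L; have := ltn_pmod (lev x + c) L_gt0;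
      move: L_gt0; clear; nia.
  exact: dvdn_mull.
- move=> w w'; rewrite !inE => /orP[wS|wQ] /orP[w'S|w'Q].
  + by rewrite !f'S //; exact: finj.
  + by rewrite f'S // f'Q // => /esym/cross; case/(_ w'Q wS).
  + by rewrite f'Q // f'S // => /cross; case/(_ wQ w'S).
  + by rewrite !f'Q //; exact: f1inj.
- move=> w; rewrite !inE => /orP[wS lw|wQ lw]; first by rewrite !f'S ?Spar ?farc.
  have [E|wx] := eqVneq w x.
    by rewrite E f'S ?f'Q ?f1x ?piece_root ?uarc ?parx // -E.
  by rewrite !f'Q ?par_piece ?f1arc.
have -> : ~: [set f' w | w in S'] = U :\: [set f1 w | w in Q].
  apply/setP => v; rewrite !inE -negb_or; congr negb.
  apply/imsetP/orP => [[w]|[]].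
  - rewrite !inE => /orP[wS|wQ] ->.
      by right; rewrite f'S // imset_f.
    by left; rewrite f'Q // imset_f.
  - by case/imsetP => w wQ ->; exists w; rewrite ?f'Q // !inE wQ orbT.
  - by case/imsetP => w wS ->; exists w; rewrite ?f'S // !inE wS.
apply: le_trans f1psi _; apply: le_trans (ler_wpM2r (expR_ge0 _) psi) _.
rewrite -[leLHS]mulrA -expRD ler_wpM2l //.
  by apply: sumr_ge0 => j _; exact: expR_ge0.
rewrite ler_expR cardS' natrD.
have -> : \sum_(w in S') unmixed w = \sum_(w in S) unmixed w + \sum_(w <- Q) unmixed w.
  rewrite (eq_bigl [predU S & Q]) => [|y]; last by rewrite !inE.
  rewrite bigU ?[in RHS]big_uniq //= disjoint_subset.
  by apply/subsetP => y yS; rewrite inE; apply: contraL yS; exact: disj.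
have : \sum_(y <- Q) gamma ^+ (lev y - lev x) <= \sum_(y <- Q) unmixed y.
  rewrite big_seq [leRHS]big_seq; apply: ler_sum => y; rewrite mem_piece //.
  move=> /andP[/andP[xy yh] _]; rewrite /unmixed; case: ltnP => yL.
    by rewrite exprn_ile1 ?gamma_ge0 ?gamma_le1.
  have lx : (0 < lev x)%N by move: hL yh yL; clear; lia.
  have /dvdnP[k Ek] := Sbd x xS (parx lx).
  have -> : (lev y + c = k * L + (lev y - lev x))%N.
    by rewrite -Ek; move: xy; clear; lia.
  by rewrite modnMDl modn_small //; move: hL yh; clear; lia.
have a0 : 0 <= a by rewrite divr_ge0 // ltW.
move/(ler_wpM2l (mulr_ge0 (ler0n R 2) a0)); rewrite -/a /A; lra.
Qed.

Lemma embed_rooted :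
  exists f : W -> V, injective f /\
    forall x, (0 < lev x)%N -> arc G (sgn x) (f (par x)) (f x).
Proof.
have [v0 _] : exists v, v \in V.
  apply/card_gt0P; rewrite -(ltr_nat R).
  by move: m_free m_gt0 (ler0n R #|W|); lra.
have good0 : good_state set0 (fun=> v0).
  split; try (by move=> x; rewrite !inE).
  have -> : [set (fun=> v0) x | x in set0 : {set W}] = set0.
    by apply/setP => v; rewrite inE; apply/imsetP => -[x]; rewrite inE.
  by rewrite setC0 cards0 big_set0 !mulr0 addr0 expR0 mulr1.
suff [f [_ _ finj farc _]] : exists f, good_state [set: W] f.
  by exists f; split=> [x y|x]; [apply: finj|apply: farc]; rewrite inE.
have [k] := ubnP (#|W| - #|set0 : {set W}|).
elim: k set0 (fun=> v0) good0 => // k IH S f good lek.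
have [E|SW] := eqVneq S [set: W]; first by exists f; rewrite -E.
have [S' [f' [good' lt]]] := good_state_extend good SW.
apply: (IH S' f' good'); have := subset_leq_card (subsetT S').
by rewrite cardsT; move: lt lek; clear; lia.
Qed.

End Embedding.

(** * Choice of the constants *)

Lemma sum_modn_shift (R : zmodType) (F : nat -> R) (L l : nat) : (0 < L)%N ->
  \sum_(c < L) F ((l + c) %% L)%N = \sum_(d < L) F d.
Proof.
case: L => // L _; elim: l => [|l IH].
  by apply: eq_bigr => c _; rewrite add0n modn_small.
rewrite -IH big_ord_recr [RHS]big_ord_recl /= addrC; congr (_ + _).
  by rewrite addSnnS modnDr addn0.
by apply: eq_bigr => c _; rewrite addSnnS.
Qed.

Lemma exists_small_shift (R : realFieldType) (W : finType) (lev : W -> nat)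
    (x : R) (L : nat) : (0 < L)%N -> 0 <= x < 1 ->
  exists c, \sum_w x ^+ ((lev w + c) %% L) <= #|W|%:R / (L%:R * (1 - x)).
Proof.
move=> L0 /andP[x0 x1]; have x1' : 0 < 1 - x by rewrite subr_gt0.
have LR : 0 < L%:R :> R by rewrite ltr0n.
have tot : \sum_(c < L) \sum_w x ^+ ((lev w + c) %% L) <= #|W|%:R / (1 - x).
  rewrite exchange_big /= mulr_natl -sumr_const; apply: ler_sum => w _.
  rewrite (sum_modn_shift (fun d => x ^+ d) (lev w) L0).
  rewrite -[leRHS]mul1r ler_pdivlMr // mulrC.
  have := subrX1 x L; rewrite -(opprB 1 x) -(opprB 1 (x ^+ L)) mulNr.
  by move/oppr_inj <-; rewrite gerBl exprn_ge0.
have [/existsP[c le_c]|/existsPn h] := boolP [exists c : 'I_L,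
    \sum_w x ^+ ((lev w + c) %% L) <= #|W|%:R / (L%:R * (1 - x))].
  by exists c.
exfalso; move: tot; apply/negP; rewrite -ltNge.
have -> : #|W|%:R / (1 - x) = \sum_(c < L) #|W|%:R / (L%:R * (1 - x)).
  by rewrite sumr_const card_ord -mulr_natl; field; rewrite !gt_eqF.
rewrite (bigD1 (Ordinal L0)) //= [ltRHS](bigD1 (Ordinal L0)) //= ltr_leD //.
  by have := h (Ordinal L0); rewrite -ltNge.
by apply: ler_sum => c _; have := h c; rewrite -ltNge => /ltW.
Qed.

Lemma subpolynomial_degree (R : realType) (C K : R) (L : nat) : 0 < K ->
  exists n0 : nat, forall n D : nat, (n0 <= n)%N ->
    D%:R <= n%:R `^ ((K * ln n%:R) `^ (- (1 / 2))) ->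
    C * ((D.+1 ^ L)%:R) ^+ 2 <= n%:R.
Proof.
move=> K0; pose j := (L * 2).+1.
have jR : 0 < j%:R :> R by rewrite ltr0n.
pose C' := 1 + `|C|.
have C'1 : 1 <= C' by rewrite lerDl.
have C'0 : 0 <= C' by apply: le_trans C'1.
have C4 : 0 <= C' * 4 ^+ L by rewrite mulr_ge0 ?exprn_ge0.
pose B := expR (j%:R ^+ 2 / K) + (C' * 4 ^+ L) ^+ j.
exists (Num.bound B) => n D nB hD.
have B0 : 0 <= (C' * 4 ^+ L) ^+ j by rewrite exprn_ge0.
have nR : B < n%:R.
  apply: lt_le_trans (archi_boundP _) _; last by rewrite ler_nat.
  by rewrite addr_ge0 // expR_ge0.
have n1 : expR (j%:R ^+ 2 / K) <= n%:R by apply: le_trans (ltW nR); rewrite lerDl.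
have n2 : (C' * 4 ^+ L) ^+ j <= n%:R.
  by apply: le_trans (ltW nR); rewrite lerDr expR_ge0.
have n0 : 0 < n%:R :> R by apply: lt_le_trans n1; exact: expR_gt0.
pose q : R := n%:R `^ j%:R^-1.
have qj : q ^+ j = n%:R.
  by rewrite /q -powR_mulrn ?powR_ge0 // -powRrM mulVf ?gt_eqF // powRr1 // ltW.
have q0 : 0 <= q by exact: powR_ge0.
have Cq : C' * 4 ^+ L <= q.
  by rewrite -(@ler_pXn2r _ j) ?nnegrE // qj.
have q1 : 1 <= q.
  by apply: le_trans Cq; rewrite mulr_ege1 // exprn_ege1 // ler1n.
have Dq : D%:R <= q.
  apply: le_trans hD _; rewrite /q ler_powR ?ler1n //; first by rewrite -(ltr0n R).
  have lnn : j%:R ^+ 2 <= K * ln n%:R.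
    rewrite mulrC -ler_pdivrMr // -(expRK (j%:R ^+ 2 / K)).
    by rewrite ler_ln ?posrE // expR_gt0.
  rewrite powRN lef_pV2 ?posrE //; last first.
    by rewrite powR_gt0 // (lt_le_trans _ lnn) // exprn_gt0.
  have -> : j%:R = (j%:R ^+ 2) `^ (1 / 2) :> R.
    rewrite -powR_mulrn ?(ltW jR) // -powRrM.
    have -> : 2%:R * (1 / 2) = 1 :> R by field.
    by rewrite powRr1 // ltW.
  rewrite ge0_ler_powR ?nnegrE ?divr_ge0 ?exprn_ge0 //.
  by apply: le_trans lnn; rewrite exprn_ge0.
rewrite -qj natrX -exprM /j exprS.
have D2q : D.+1%:R <= 2 * q by rewrite -addn1 natrD; move: Dq q1; lra.
apply: (@le_trans _ _ (C' * (2 * q) ^+ (L * 2))).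
  apply: (@le_trans _ _ (C' * D.+1%:R ^+ (L * 2))).
    rewrite ler_wpM2r ?exprn_ge0 //.
    by apply: le_trans (ler_norm _) _; rewrite lerDr.
  by rewrite ler_wpM2l // lerXn2r ?nnegrE // mulr_ge0.
rewrite exprMn mulrA ler_wpM2r ?exprn_ge0 //.
by rewrite mulnC exprM (_ : 2 ^+ 2 = 4 :> R) // expr2; ring.
Qed.

Lemma rounds_near (R : realType) (m : nat) (x : R) : rounds m x ->
  x - 1 <= m%:R <= x + 1.
Proof.
have -> : m%:R = (m%:Z)%:~R :> R by [].
case=> ->; apply/andP.
  have := floor_le x; have := floorD1_gt x; rewrite intrD; split; lra.
have := ceil_ge x; have := ceilB1_lt x; rewrite intrB; split; lra.
Qed.

Lemma min_semidegree_le (V : finType) (G : rel V) (i : bool * V) :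
  (min_semidegree G <= degin G [set: V] i)%N.
Proof.
apply: (@leq_trans (minn (outdeg G i.2) (indeg G i.2))).
  rewrite /min_semidegree; elim: (index_enum V) (mem_index_enum i.2) => // x s IH.
  rewrite inE big_cons geq_min => /orP[/eqP->|/IH->]; last by rewrite orbT.
  by rewrite leqnn.
rewrite geq_min; case: i => -[] v /=; apply/orP; [left|right];
  by rewrite subset_leq_card //; apply/subsetP => u; rewrite !inE.
Qed.

Lemma expR_gt_quadratic (R : realType) (y : R) : 0 <= y -> y ^+ 2 / 4 < expR y.
Proof.
move=> y0; have -> : y = 2%:R * (y / 2) by field.
rewrite expRM_natl.
have := expR_ge1Dx (y / 2) => h.
apply: (@lt_le_trans _ _ ((1 + y / 2) ^+ 2)).
  nra.
by rewrite lerXn2r ?nnegrE ?expR_ge0 //; lra.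
Qed.

Lemma bernoulli_le (R : realFieldType) (x : R) (L : nat) : 0 <= x <= 1 ->
  (1 + x) ^+ L <= 1 + (2 ^+ L - 1) * x.
Proof.
move=> /andP[x0 x1]; elim: L => [|L IH]; first by rewrite !expr0; lra.
have p1 : 1 <= 2 ^+ L :> R by rewrite exprn_ege1 // ler1n.
rewrite exprS; apply: (@le_trans _ _ ((1 + x) * (1 + (2 ^+ L - 1) * x))).
  by apply: ler_wpM2l IH; rewrite addr_ge0.
rewrite exprS -subr_ge0.
have -> : 1 + (2 * 2 ^+ L - 1) * x - (1 + x) * (1 + (2 ^+ L - 1) * x) =
  (2 ^+ L - 1) * (x * (1 - x)) by ring.
by rewrite mulr_ge0 ?mulr_ge0 ?subr_ge0.
Qed.

Theorem theorem1p8 (R : realType) (alpha : R) (alpha_gt0 : 0 < alpha) :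
  exists2 lambda0 : R, 0 < lambda0 &
  forall lambda : R, 0 < lambda < lambda0 ->
  exists2 kappa0 : R, 0 < kappa0 &
  forall K : R, 0 < K^-1 < kappa0 ->
  exists n0 : nat, forall n : nat, (n0 <= n)%N ->
  forall (V : finType) (G : rel V),
    digraph G ->
    rounds #|V| ((1 + alpha) * n%:R) ->
    (1 / 2 + alpha) * n%:R <= (min_semidegree G)%:R ->
  forall (W : finType) (T : rel W),
    oriented_tree T ->
    #|W| = n ->
    (max_degree (underlying T))%:R <= n%:R `^ ((K * ln n%:R) `^ (- (1 / 2))) ->
    contains G T.
Proof.
exists 1 => // lambda _; exists 1 => // K /andP[K0 _]; rewrite invr_gt0 in K0.
have [beta betaE] : exists x : R, x = alpha / 2 by eexists.
have beta0 : 0 < beta by rewrite betaE divr_gt0.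
have large_nat (x : R) : 0 <= x -> exists2 k : nat, (0 < k)%N & x <= k%:R.
  move=> x0; exists (Num.bound x).+1 => //.
  by apply: le_trans (ltW (archi_boundP x0)) _; rewrite ler_nat.
have [|t t_gt0N tR] := large_nat (8 * (1 + alpha) / alpha + alpha).
  by rewrite addr_ge0 ?divr_ge0 ?mulr_ge0 ?addr_ge0 // ltW.
have t_gt0 : 0 < t%:R :> R by rewrite ltr0n.
have t_ge0 := ltW t_gt0.
have t_1 : 1 <= t%:R :> R by rewrite ler1n.
have alpha_ge0 := ltW alpha_gt0.
have beta_ge0 := ltW beta0.
have t_alpha : alpha <= t%:R.
  by apply: le_trans tR; rewrite lerDr divr_ge0 ?mulr_ge0 ?addr_ge0 // ltW.
have t_eps : 8 * (1 + alpha) <= alpha * t%:R.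
  rewrite [leRHS]mulrC -ler_pdivrMr //; apply: le_trans tR.
  by rewrite lerDl ltW.
have [|L L_gt0N LR] := large_nat (16 * t%:R ^+ 3 / beta).
  by rewrite divr_ge0 ?mulr_ge0 ?exprn_ge0.
have L_gt0 : 0 < L%:R :> R by rewrite ltr0n.
have [eta etaE] : exists x : R, x = beta / (8 * t%:R) by eexists.
have eta0 : 0 < eta by rewrite etaE divr_gt0 ?mulr_gt0.
have [tau tauE] : exists x : R, x = beta ^+ 2 / (16 * t%:R) by eexists.
have tau0 : 0 < tau by rewrite tauE divr_gt0 ?mulr_gt0 ?exprn_gt0.
have [C1 C1E] : exists x : R, x = 16 * t%:R / beta by eexists.
have [C2 C2E] : exists x : R, x = 2 ^+ L * (4 * t%:R) / (beta * eta) by eexists.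
have [C3 C3E] : exists x : R, x = 32 * t%:R ^+ 2 * (2 + alpha) / tau ^+ 2 by eexists.
pose C := C1 + C2 + C3.
have C10 : 0 <= C1 by rewrite C1E divr_ge0 ?mulr_ge0 // ltW.
have C20 : 0 <= C2 by rewrite C2E divr_ge0 ?mulr_ge0 ?exprn_ge0 // ltW.
have C30 : 0 <= C3 by rewrite C3E divr_ge0 ?mulr_ge0 ?exprn_ge0 ?addr_ge0 // ltW.
have [n1 n1P] := @subpolynomial_degree R C K L K0.
pose B := 1 + 12 / alpha.
exists (maxn n1 (Num.bound B)) => n; rewrite geq_max => /andP[n1n nB] V G _
  cardV degG
  W T [orT treeT] cardW maxdegT.
have {nB} nB : B < n%:R.
  apply: lt_le_trans (archi_boundP _) _; last by rewrite ler_nat.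
  by rewrite addr_ge0 // divr_ge0 // ltW.
have n_1 : 1 <= n%:R :> R.
  by apply: ltW; apply: le_lt_trans nB; rewrite lerDl divr_ge0 // ltW.
have n_alpha : 12 <= alpha * n%:R.
  rewrite mulrC -ler_pdivrMr //; apply: ltW; apply: le_lt_trans nB.
  by rewrite lerDr.
have n_gt0 : 0 < n%:R :> R by apply: lt_le_trans n_1.
pose D := max_degree (underlying T).
pose s := (D.+1 ^ L)%N.
have sC : C * s%:R ^+ 2 <= n%:R by apply: n1P maxdegT.
have s_1 : 1 <= s%:R :> R by rewrite ler1n expn_gt0.
have s_gt0 : 0 < s%:R :> R by apply: lt_le_trans s_1.
have s2_1 : s%:R <= s%:R ^+ 2 :> R by rewrite expr2 ler_peMl // ltW.
have s_C1 : C1 * s%:R <= n%:R.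
  apply: le_trans sC; apply: ler_pM => //.
  by rewrite /C -addrA lerDl addr_ge0.
have s_C2 : C2 * s%:R <= n%:R.
  apply: le_trans sC; apply: ler_pM => //.
  by rewrite /C [C1 + C2]addrC -addrA lerDl addr_ge0.
have s_C3 : C3 * s%:R ^+ 2 <= n%:R.
  apply: le_trans sC; rewrite ler_wpM2r ?sqr_ge0 // /C lerDr addr_ge0 //.
have [Nlo Nhi] := andP (rounds_near cardV).
have [_ gsym _ _ _] := treeT.
have [z [par [lev rooted]]] := tree_rooted treeT.
have [lev_par lev0 _ gpar] := rooted.
pose gamma : R := 1 - (t%:R ^+ 2)^-1.
have gamma01 : 0 <= gamma < 1.
  by rewrite gamma_ge0 //= ltrBlDr ltrDl invr_gt0 exprn_gt0.
have [c cP] := exists_small_shift lev L_gt0N gamma01.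
have [theta thetaE] : exists x : R, x = tau * n%:R / s%:R by eexists.
have theta0 : 0 < theta by rewrite thetaE divr_gt0 ?mulr_gt0.
have [m mE] : exists x : R, x = beta * n%:R by eexists.
have m0 : 0 < m by rewrite mE mulr_gt0.
pose sgn x := T (par x) x.
have sizes h y : (h < L)%N -> (size (piece par lev h y) <= s)%N.
  move=> hL; apply: (@leq_trans (D.+1 ^ h)).
    apply: size_piece => x; apply: leq_trans (size_children x gsym rooted).
    have uc : uniq (children par lev x) by rewrite filter_uniq ?enum_uniq.
    rewrite -(card_uniqP uc) subset_leq_card //.
    by apply/subsetP => d; rewrite inE mem_children.
  by rewrite leq_pexp2l // ltnW.
suff [f [finj farc]] : exists f : W -> V, injective f /\
    forall x, (0 < lev x)%N -> arc G (sgn x) (f (par x)) (f x).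
  exists f; split=> // x y Txy.
  have uxy : underlying T x y by rewrite /underlying /= Txy.
  case: (gpar x y uxy) => -[l E].
    by have := farc y l; rewrite /sgn E Txy.
  by have := farc x l; rewrite /sgn E (negPf (orT x y Txy)).
have beta_t : beta <= t%:R by rewrite betaE; lra.
have eta1 : eta <= 1 by rewrite etaE ler_pdivrMr ?mulr_gt0 //; lra.
have tau_beta : tau <= beta / 16.
  rewrite tauE ler_pdivrMr ?mulr_gt0 //.
  have -> : beta / 16 * (16 * t%:R) = beta * t%:R by field.
  by rewrite expr2 ler_wpM2l.
have degree_room : (1 / 2 + 2 / t%:R) * #|V|%:R <= (1 / 2 + alpha) * n%:R.
  have u2 : 2 / t%:R <= 2 :> R by rewrite ler_pdivrMr //; lra.
  have u0 : 0 <= 2 / t%:R :> R by rewrite divr_ge0.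
  have ua : 2 / t%:R * (1 + alpha) <= alpha / 4.
    by rewrite mulrAC ler_pdivrMr //; lra.
  apply: (@le_trans _ _ ((1 / 2 + 2 / t%:R) * ((1 + alpha) * n%:R + 1))).
    by rewrite ler_wpM2l // addr_ge0 // divr_ge0.
  have := ler_wpM2r (ltW n_gt0) ua; move: u2 n_alpha; clear.
  set u := 2 / _; lra.
apply: (@embed_rooted R V G W (underlying T) z par lev sgn t s L c theta m eta) => //.
- by rewrite cardW mE betaE; lra.
- rewrite mE !natrM -ler_pdivrMl //; apply: le_trans s_C1.
  rewrite C1E -subr_ge0.
  have -> : 16 * t%:R / beta * s%:R - beta^-1 * (4%:R * t%:R * s%:R) =
    12 * (t%:R * s%:R / beta) by field; rewrite gt_eqF.
  by rewrite mulr_ge0 // divr_ge0 ?mulr_ge0 // ltW.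
- rewrite thetaE mE divfK ?gt_eqF //.
  by apply: le_trans (ler_wpM2r (ltW n_gt0) tau_beta) _; have := mulr_gt0 beta0 n_gt0; lra.
- have x0 : 0 <= (4 * t * s)%:R / m by rewrite divr_ge0 ?ler0n // ltW.
  have x2 : 2 ^+ L * ((4 * t * s)%:R / m) <= eta.
    rewrite mulrA ler_pdivrMr // mE.
    move: s_C2; rewrite C2E mulrAC ler_pdivrMr ?mulr_gt0 // !natrM.
    have -> : 2 ^+ L * (4 * t%:R) * s%:R = 2 ^+ L * (4%:R * t%:R * s%:R) :> R by ring.
    by have -> : n%:R * (beta * eta) = eta * (beta * n%:R) by ring.
  have p1 : 1 <= 2 ^+ L :> R by rewrite exprn_ege1 // ler1n.
  have x1 : (4 * t * s)%:R / m <= 2 ^+ L * ((4 * t * s)%:R / m) by rewrite ler_peMl.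
  apply: le_trans (bernoulli_le L _) _; first by rewrite x0 /=; lra.
  by rewrite lerD2l mulrBl mul1r; lra.
set E := \sum_x _.
have E_le : E <= t%:R ^+ 2 * n%:R / L%:R + s%:R.
  apply: (@le_trans _ _ (\sum_x (gamma ^+ ((lev x + c) %% L) + (lev x < L)%N%:R))).
    apply: ler_sum => x _; rewrite /unmixed; case: ifP => _; last by rewrite addr0.
    by rewrite lerDr exprn_ge0 //; have /andP[] := gamma01.
  rewrite big_split lerD //=.
    apply: le_trans cP _; rewrite cardW /gamma opprB addrC subrK.
    rewrite le_eqVlt; apply/orP; left; apply/eqP; field.
    by rewrite !gt_eqF.
  have zP : (#|[set x | (lev x < L)%N]| <= s)%N.
    apply: leq_trans (sizes L.-1 z _); last by rewrite prednK.
    have uz : uniq (piece par lev L.-1 z) by exact: uniq_piece.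
    rewrite -(card_uniqP uz) subset_leq_card //; apply/subsetP => x.
    have lz : lev z = 0%N by apply/eqP; rewrite lev0.
    rewrite inE mem_piece // lz subn0 /= add0n => xL.
    by rewrite -ltnS prednK // xL -lev0 lev_iter // subnn.
  rewrite -natr_sum ler_nat; apply: leq_trans zP.
  rewrite -sum1_card [leqRHS]big_mkcond; apply: leq_sum => x _.
  by rewrite inE; case: (lev x < L)%N.
have V_gt0 : 0 < #|V|%:R :> R.
  by apply: lt_le_trans Nlo; rewrite mulrDl mul1r; lra.
have pot0 : potential G theta [set: V] <=
    2 * #|V|%:R * expR (- theta * (1 / 2 + 2 / t%:R)).
  apply: (@le_trans _ _ (\sum_(i : bool * V) expR (- theta * (1 / 2 + 2 / t%:R)))).
    apply: ler_sum => i _; rewrite ler_expR !mulNr lerN2 ler_wpM2l ?(ltW theta0) //.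
    rewrite /ratio cardsT ler_pdivlMr //; apply: le_trans degree_room _.
    by apply: le_trans degG _; rewrite ler_nat min_semidegree_le.
  by rewrite sumr_const card_prod card_bool -(mulr_natl _ (2 * #|V|)) natrM.
apply: le_lt_trans (ler_wpM2r (expR_ge0 _) pot0) _.
rewrite -[ltLHS]mulrA -expRD cardW.
have expo : (2 * (theta / m) ^+ 2 * s%:R + theta / m * eta) * n%:R +
    2 * (theta / m) * E <= theta / (2 * t%:R).
  have -> : theta / (2 * t%:R) = theta / (8 * t%:R) + theta / (8 * t%:R) +
     2 * (theta / m) * (m / (8 * t%:R)).
    by rewrite mE; field; rewrite !gt_eqF.
  have T1 : 2 * (theta / m) ^+ 2 * s%:R * n%:R = theta / (8 * t%:R).
    have -> : 2 * (theta / m) ^+ 2 * s%:R * n%:R =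
        theta * (2 * (theta * s%:R / n%:R) / beta ^+ 2).
      by rewrite mE; field; rewrite !gt_eqF.
    by rewrite thetaE tauE; field; rewrite !gt_eqF.
  have T2 : theta / m * eta * n%:R = theta / (8 * t%:R).
    by rewrite mE etaE; field; rewrite !gt_eqF.
  rewrite mulrDl T1 T2 lerD2l; apply: ler_wpM2l.
    by rewrite mulr_ge0 // divr_ge0 // ltW.
  apply: le_trans E_le _.
  have -> : m / (8 * t%:R) = beta * n%:R / (16 * t%:R) + beta * n%:R / (16 * t%:R).
    by rewrite mE; field; rewrite !gt_eqF.
  apply: lerD.
    rewrite ler_pdivrMr //.
    move: LR; rewrite ler_pdivrMr // => LR.
    have -> : beta * n%:R / (16 * t%:R) * L%:R = n%:R / (16 * t%:R) * (L%:R * beta) by ring.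
    have -> : t%:R ^+ 2 * n%:R = n%:R / (16 * t%:R) * (16 * t%:R ^+ 3) :> R.
      by field; rewrite gt_eqF.
    by rewrite ler_wpM2l // divr_ge0 ?mulr_ge0 // ltW.
  rewrite ler_pdivlMr ?mulr_gt0 //; move: s_C1; rewrite C1E mulrAC ler_pdivrMr //.
  by rewrite [n%:R * _]mulrC [s%:R * _]mulrC.
have Vn : #|V|%:R <= (2 + alpha) * n%:R.
  by apply: le_trans Nhi _; rewrite !mulrDl; lra.
have big : 2 * #|V|%:R < expR (theta / (2 * t%:R)).
  apply: le_lt_trans (expR_gt_quadratic _); last first.
    by rewrite divr_ge0 ?mulr_ge0 // ltW.
  have -> : (theta / (2 * t%:R)) ^+ 2 / 4 =
      n%:R * (tau ^+ 2 * n%:R) / (16 * t%:R ^+ 2 * s%:R ^+ 2).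
    by rewrite thetaE; field; rewrite !gt_eqF.
  rewrite ler_pdivlMr ?mulr_gt0 ?exprn_gt0 //.
  move: s_C3; rewrite C3E mulrAC ler_pdivrMr ?exprn_gt0 // => h.
  apply: (@le_trans _ _ (2 * ((2 + alpha) * n%:R) * (16 * t%:R ^+ 2 * s%:R ^+ 2))).
    by rewrite ler_wpM2r ?mulr_ge0 ?exprn_ge0 // ler_wpM2l.
  have -> : 2 * ((2 + alpha) * n%:R) * (16 * t%:R ^+ 2 * s%:R ^+ 2) =
    n%:R * (32 * t%:R ^+ 2 * (2 + alpha) * s%:R ^+ 2) by ring.
  by rewrite ler_wpM2l // [tau ^+ 2 * _]mulrC.
apply: lt_le_trans (_ : expR (theta / (2 * t%:R)) *
   expR (- theta * (1 / 2 + 2 / t%:R) + theta / (2 * t%:R)) <= _).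
  apply: (@le_lt_trans _ _ (2 * #|V|%:R *
      expR (- theta * (1 / 2 + 2 / t%:R) + theta / (2 * t%:R)))).
    rewrite ler_wpM2l ?mulr_ge0 // ler_expR lerD2l //.
  by rewrite ltr_pM2r ?expR_gt0.
rewrite -expRD le_eqVlt; apply/orP; left; apply/eqP; congr expR; field.
by rewrite gt_eqF.
Qed.
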